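(* Let $T$ be a binary search tree with $n$ vertices, labeled by $1,\dots,n$ according to the in-order algorithm, and let $\trianglelefteq_T$ be the associated partial order on $\{1,\dots,n\}$. Then the quasi-hereditary algebra $(A_n,\trianglelefteq_T)$ has a regular exact Borel subalgebra.
   Context: $K$ is an algebraically closed field and $A_n$ is the path algebra over $K$ of the quiver $1\to 2\to\cdots\to n$. Modules are finite-dimensional left modules; $L(i)$ is the simple module at vertex $i$ and $P(i)$ its projective cover. A binary tree is either empty or a triple consisting of a root and two binary trees, its left and right subtrees. The in-order algorithm labels the $n$ vertices by $1,\dots,n$ by recursively visiting the left subtree, then the root, then the right subtree. The partial order $\trianglelefteq_T$ is: $i\triangleleft_T j$ iff $i$ labels a vertex in the left or right subtree of the vertex labeled $j$. The standard module $\Delta(i)$ is the largest quotient of $P(i)$ all of whose composition factors $L(j)$ satisfy $j\trianglelefteq_T i$. The algebra $A_n$ is quasi-hereditary with respect to $\trianglelefteq_T$. Quasi-hereditary: a finite-dimensional algebra $\Lambda$ with simple modules indexed by a partially ordered set is quasi-hereditary if for each $i$ the kernel of $P(i)\twoheadrightarrow\Delta(i)$ has a filtration with subquotients $\Delta(j)$, $j\triangleright i$, and the kernel of $\Delta(i)\twoheadrightarrow L(i)$ has a filtration with subquotients $L(j)$, $j\triangleleft i$. Regular exact Borel subalgebra: let $(\Lambda,\trianglelefteq)$ be quasi-hereditary with $n$ simple modules up to isomorphism. A subalgebra $B\subset\Lambda$ is an exact Borel subalgebra if (i) $B$ also has $n$ simple modules $L_B(1),\dots,L_B(n)$ up to isomorphism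 and $(B,\trianglelefteq)$ is quasi-hereditary with simple standard modules; (ii) the functor $\Lambda\otimes_B-$ is exact; (iii) $\Lambda\otimes_B L_B(i)\cong\Delta_\Lambda(i)$ for all $i$. It is regular if moreover the maps $\operatorname{Ext}_B^k(L_B(i),L_B(j))\to\operatorname{Ext}_\Lambda^k(\Lambda\otimes_BL_B(i),\Lambda\otimes_BL_B(j))$ induced by $\Lambda\otimes_B-$ are isomorphisms for all $k\ge 1$ and all $i,j$. *)

(* Defs.v *)
From HB Require Import structures.
From mathcomp Require Import all_boot all_order all_algebra all_field.
From mathcomp Require Import boolp.

Set Implicit Arguments.
Unset Strict Implicit.
Unset Printing Implicit Defensive.

Import GRing.Theory.
Local Open Scope ring_scope.

Section BinaryTrees.

Inductive bintree := Empty | Node of bintree & bintree.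

Fixpoint nvertices (t : bintree) : nat :=
  if t is Node l r then (nvertices l + nvertices r).+1 else 0.

Inductive labtree := LEmpty | LNode of labtree & nat & labtree.

(* Labels start at k; with k = 0 the vertices get 0, ..., n - 1, which matches *)
(* the vertex type 'I_n of the quiver.                                         *)
Fixpoint inorder (k : nat) (t : bintree) : labtree :=
  if t is Node l r then
    let root := (k + nvertices l)%N in
    LNode (inorder k l) root (inorder root.+1 r)
  else LEmpty.

Fixpoint labels (t : labtree) : seq nat :=
  if t is LNode l x r then labels l ++ x :: labels r else [::].

Fixpoint in_subtree_of (t : labtree) (i j : nat) : bool :=
  if t is LNode l x r then
    [|| (j == x) && (i \in labels l ++ labels r),
        in_subtree_of l i j | in_subtree_of r i j]
  else false.

Definition tree_le n (t : bintree) : rel 'I_n :=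
  fun i j => (i == j) || in_subtree_of (inorder 0 t) i j.

End BinaryTrees.

Section PathAlgebra.

Section LinearQuiver.

Variable n : nat.

(* The quiver is 0 -> 1 -> ... -> n, with n.+1 vertices.                       *)
Definition arrow : rel 'I_n.+1 := fun i j => nat_of_ord j == i.+1.

(* There are no parallel arrows, so a path is given by its source and the     *)
(* sequence of the vertices visited afterwards.                                *)
Definition is_qpath (p : 'I_n.+1 * seq 'I_n.+1) : bool := path arrow p.1 p.2.

Record qpath := QPath { qpval :> 'I_n.+1 * seq 'I_n.+1; _ : is_qpath qpval }.

HB.instance Definition _ := [isSub for qpval].
HB.instance Definition _ := [Countable of qpath by <:].

Definition psrc (p : qpath) : 'I_n.+1 := (qpval p).1.
Definition ptgt (p : qpath) : 'I_n.+1 := last (qpval p).1 (qpval p).2.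

Definition idpath (i : 'I_n.+1) : qpath := @QPath (i, [::]) isT.

(* First p, then q. *)
Definition pcomp (q p : qpath) : option qpath :=
  if ptgt p == psrc q then insub (psrc p, (qpval p).2 ++ (qpval q).2) else None.

Lemma arrow_path_nth x s :
  path arrow x s -> map val s = iota (val x).+1 (size s).
Proof.
by elim: s x => //= y s IHs x /andP[/eqP/= yx /IHs ->]; rewrite yx.
Qed.

Lemma arrow_path_size x s : path arrow x s -> (size s < n.+1)%N.
Proof.
move=> /arrow_path_nth Es; rewrite ltnNge; apply/negP => ns.
have: nth 0%N (map val s) n = (x + n).+1.
  by rewrite Es nth_iota // addSn.
rewrite (nth_map ord0) // => E.
have := ltn_ord (nth ord0 s n); rewrite [nat_of_ord _]E ltnS.
by rewrite leqNgt ltnS leq_addl.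
Qed.

Definition qpath_code (p : qpath) : 'I_n.+1 * n.-bseq 'I_n.+1 :=
  ((qpval p).1, insub_bseq n (qpval p).2).
Definition qpath_decode (c : 'I_n.+1 * n.-bseq 'I_n.+1) : option qpath :=
  insub (c.1, c.2 : seq _).

Lemma qpath_codeK : pcancel qpath_code qpath_decode.
Proof.
case=> -[x s] sP; rewrite /qpath_decode /= insubdK.
  by rewrite (insubT _ sP).
by rewrite -[_ \in _]ltnS; apply: arrow_path_size sP.
Qed.

HB.instance Definition _ : isFinite qpath := PCanIsFinite qpath_codeK.

End LinearQuiver.

Variables (K : fieldType) (n : nat).
Local Notation Q := (qpath n).

(* Linear combinations of paths; a product of paths is a composition from      *)
(* right to left, so left modules are representations of the quiver.           *)
Definition pathalg : Type := {ffun Q -> K^o}.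

HB.instance Definition _ := Vector.on pathalg.

Implicit Types f g h : pathalg.

Definition pmul f g : pathalg :=
  [ffun p => \sum_q \sum_(r | pcomp q r == Some p) (f q : K) * g r].

Definition pone : pathalg := [ffun p : Q => ((qpval p).2 == [::])%:R].

Lemma pcompE (q p : Q) : ptgt p = psrc q ->
  {pq | pcomp q p = Some pq & qpval pq = (psrc p, (qpval p).2 ++ (qpval q).2)}.
Proof.
case: q p => [[y t] tP] [[x s] sP]; rewrite /pcomp /ptgt /psrc /= => xy.
have stP : is_qpath (x, s ++ t).
  rewrite /is_qpath /= cat_path xy; exact/andP.
by exists (QPath stP); rewrite //= xy eqxx (insubT _ stP).
Qed.

Lemma pcompN (q p : Q) : ptgt p != psrc q -> pcomp q p = None.
Proof. by rewrite /pcomp => /negPf ->. Qed.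

Lemma pcompA (a b c : Q) :
  obind (pcomp a) (pcomp b c) = obind (fun ab => pcomp ab c) (pcomp a b).
Proof.
have [bc|bc] := eqVneq (ptgt c) (psrc b); last first.
  rewrite (pcompN bc) /=; have [ab|ab] := eqVneq (ptgt b) (psrc a).
    have [ab' -> Eab] /= := pcompE ab; rewrite pcompN //.
    by rewrite [psrc ab']/psrc Eab.
  by rewrite (pcompN ab).
have [bc' -> Ebc] /= := pcompE bc.
have tbc : ptgt bc' = ptgt b.
  by rewrite /ptgt Ebc /= last_cat; move: bc; rewrite /ptgt /psrc => ->.
have [ab|ab] := eqVneq (ptgt b) (psrc a); last first.
  by rewrite (pcompN ab) pcompN // tbc.
have [ab' -> Eab] /= := pcompE ab.
have [u -> Eu] := pcompE (etrans tbc ab).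
have sab : ptgt c = psrc ab' by rewrite [psrc ab']/psrc Eab.
have [v -> Ev] := pcompE sab.
congr Some; apply: val_inj; rewrite /= Eu Ev /psrc Ebc Eab /=.
by rewrite catA.
Qed.

Lemma pmulE f g p : pmul f g p =
  \sum_q \sum_r (f q : K) * g r * (pcomp q r == Some p)%:R.
Proof.
rewrite ffunE; apply: eq_bigr => q _; rewrite big_mkcond /=.
by apply: eq_bigr => r _; case: ifP; rewrite ?mulr1 ?mulr0.
Qed.

Lemma sum_obind (o : option Q) (F : Q -> option Q) (p : Q) :
  \sum_w (F w == Some p)%:R * (o == Some w)%:R
    = (obind F o == Some p)%:R :> K.
Proof.
case: o => [w0|] /=; last by rewrite big1 // => w _; rewrite mulr0.
rewrite (bigD1 w0) //= eqxx mulr1 big1 ?addr0 // => w ww0.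
rewrite (_ : (Some w0 == Some w) = false) ?mulr0 //.
by apply: contraNF ww0 => /eqP[->].
Qed.

Lemma pmulA : associative pmul.
Proof.
move=> f g h; apply/ffunP => p.
transitivity (\sum_a \sum_b \sum_c (f a : K) * g b * h c *
    (obind (pcomp a) (pcomp b c) == Some p)%:R).
  rewrite pmulE; apply: eq_bigr => a _.
  under eq_bigr => w _ do rewrite pmulE mulr_sumr mulr_suml.
  rewrite exchange_big /=; apply: eq_bigr => b _.
  under eq_bigr => w _ do rewrite mulr_sumr mulr_suml.
  rewrite exchange_big /=; apply: eq_bigr => c _.
  rewrite -sum_obind mulr_sumr; apply: eq_bigr => w _.
  by rewrite !mulrA -!mulrA [X in _ * (_ * (_ * X))]mulrC.
under eq_bigr => a _ do (under eq_bigr => b _ do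
  (under eq_bigr => c _ do rewrite pcompA)).
transitivity (\sum_w \sum_c \sum_a \sum_b (f a : K) * g b * h c *
    ((pcomp w c == Some p)%:R * (pcomp a b == Some w)%:R)); last first.
  rewrite pmulE; apply: eq_bigr => w _; apply: eq_bigr => c _.
  rewrite pmulE !mulr_suml; apply: eq_bigr => a _.
  rewrite !mulr_suml; apply: eq_bigr => b _.
  by rewrite -!mulrA; do 2!congr (_ * _); rewrite mulrA mulrC.
transitivity (\sum_a \sum_w \sum_c \sum_b (f a : K) * g b * h c *
    ((pcomp w c == Some p)%:R * (pcomp a b == Some w)%:R)).
  apply: eq_bigr => a _; rewrite [RHS]exchange_big /=.
  transitivity (\sum_b \sum_c \sum_w (f a : K) * g b * h c *
      ((pcomp w c == Some p)%:R * (pcomp a b == Some w)%:R)).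
    apply: eq_bigr => b _; apply: eq_bigr => c _.
    by rewrite -mulr_sumr sum_obind.
  rewrite exchange_big /=; apply: eq_bigr => c _.
  by rewrite exchange_big.
rewrite [LHS]exchange_big /=; apply: eq_bigr => w _.
by rewrite exchange_big.
Qed.

Lemma pcomp_idl (i : 'I_n.+1) (p : Q) :
  pcomp (idpath i) p = if ptgt p == i then Some p else None.
Proof.
rewrite /pcomp /psrc /=; case: ifP => // _; rewrite cats0.
by case: p => -[x s] sP; rewrite (insubT _ sP).
Qed.

Lemma pcomp_idr (i : 'I_n.+1) (p : Q) :
  pcomp p (idpath i) = if i == psrc p then Some p else None.
Proof.
rewrite /pcomp /psrc /ptgt /=; case: eqP => // ->.
by case: p => -[x s] sP; rewrite (insubT _ sP).
Qed.

Lemma pmul1l : left_id pone pmul.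
Proof.
move=> f; apply/ffunP => p; rewrite pmulE exchange_big /=.
rewrite (bigD1 p) //= [X in _ + X]big1 ?addr0; last first.
  move=> r rp; apply: big1 => -[[x s] sP] _; rewrite ffunE /=.
  case: eqP => [s0|]; last by rewrite !mul0r.
  have -> : QPath sP = idpath x by apply: val_inj; rewrite /= s0.
  rewrite pcomp_idl; case: ifP => // _; last by rewrite mulr0.
  rewrite (_ : (Some r == Some p) = false) ?mulr0 //.
  by apply: contraNF rp => /eqP[->].
rewrite (bigD1 (idpath (ptgt p))) //= big1 ?addr0.
  by rewrite ffunE pcomp_idl !eqxx mul1r mulr1.
move=> -[[x s] sP] xp; rewrite ffunE /=.
case: eqP => [s0|]; last by rewrite !mul0r.
have E : QPath sP = idpath x by apply: val_inj; rewrite /= s0.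
rewrite E in xp *; rewrite pcomp_idl; case: ifP => [/eqP px|_]; last by rewrite mulr0.
by rewrite px eqxx in xp.
Qed.

Lemma pmul1r : right_id pone pmul.
Proof.
move=> f; apply/ffunP => p; rewrite pmulE.
rewrite (bigD1 p) //= [X in _ + X]big1 ?addr0; last first.
  move=> r rp; apply: big1 => -[[x s] sP] _; rewrite ffunE /=.
  case: eqP => [s0|]; last by rewrite !(mulr0, mul0r).
  have -> : QPath sP = idpath x by apply: val_inj; rewrite /= s0.
  rewrite pcomp_idr; case: ifP => // _; last by rewrite mulr0.
  rewrite (_ : (Some r == Some p) = false) ?mulr0 //.
  by apply: contraNF rp => /eqP[->].
rewrite (bigD1 (idpath (psrc p))) //= big1 ?addr0.
  by rewrite ffunE pcomp_idr !eqxx !mulr1.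
move=> -[[x s] sP] xp; rewrite ffunE /=.
case: eqP => [s0|]; last by rewrite !(mulr0, mul0r).
have E : QPath sP = idpath x by apply: val_inj; rewrite /= s0.
rewrite E in xp *; rewrite pcomp_idr; case: ifP => [/eqP px|_]; last by rewrite mulr0.
by rewrite -px eqxx in xp.
Qed.

Lemma pmulDl : left_distributive pmul +%R.
Proof.
move=> f g h; apply/ffunP => p; rewrite pmulE [RHS]ffunE !pmulE -big_split /=.
apply: eq_bigr => q _; rewrite -big_split; apply: eq_bigr => r _.
by rewrite ffunE !mulrDl.
Qed.

Lemma pmulDr : right_distributive pmul +%R.
Proof.
move=> f g h; apply/ffunP => p; rewrite pmulE [RHS]ffunE !pmulE -big_split /=.
apply: eq_bigr => q _; rewrite -big_split; apply: eq_bigr => r _.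
by rewrite ffunE mulrDr mulrDl.
Qed.

Lemma pone_neq0 : pone != 0.
Proof.
apply/eqP => /ffunP /(_ (idpath ord0)); rewrite !ffunE eqxx.
by apply/eqP; apply: oner_neq0.
Qed.

HB.instance Definition _ := GRing.Zmodule_isNzRing.Build pathalg
  pmulA pmul1l pmul1r pmulDl pmulDr pone_neq0.

Lemma pathalg_mulE f g p :
  (f * g) p = \sum_q \sum_(r | pcomp q r == Some p) (f q : K) * g r.
Proof. by rewrite [LHS]ffunE. Qed.

Let mulE f g p :
  (f * g) p = \sum_q \sum_r (f q : K) * g r * (pcomp q r == Some p)%:R.
Proof. exact: pmulE. Qed.

Lemma pscaleAl (k : K) f g : k *: (f * g) = (k *: f) * g.
Proof.
apply/ffunP => p; rewrite [LHS]ffunE !mulE scaler_sumr.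
apply: eq_bigr => q _; rewrite scaler_sumr; apply: eq_bigr => r _.
by rewrite ffunE /GRing.scale /= !mulrA.
Qed.

Lemma pscaleAr (k : K) f g : k *: (f * g) = f * (k *: g).
Proof.
apply/ffunP => p; rewrite [LHS]ffunE !mulE scaler_sumr.
apply: eq_bigr => q _; rewrite scaler_sumr; apply: eq_bigr => r _.
by rewrite ffunE /GRing.scale /= !mulrA [k * _]mulrC.
Qed.

HB.instance Definition _ := GRing.Lmodule_isLalgebra.Build K pathalg pscaleAl.
HB.instance Definition _ := GRing.Lalgebra_isAlgebra.Build K pathalg pscaleAr.
HB.instance Definition _ := Algebra_isFalgebra.Build K pathalg.

(* L(i): the one-dimensional module on which e_i acts as the identity and all  *)
(* other paths act as zero.                                                    *)
Definition vertex_simple (i : 'I_n.+1) : Type := K.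

Section VertexSimple.

Variable i : 'I_n.+1.

HB.instance Definition _ := GRing.Zmodule.on (vertex_simple i).

Definition vscale f (x : vertex_simple i) : vertex_simple i :=
  ((f (idpath i) : K) * (x : K)).

Lemma vscaleA f g x : vscale f (vscale g x) = vscale (f * g) x.
Proof.
rewrite /vscale mulrA; congr (_ * _); rewrite mulE.
have pcomp_id q r : (pcomp q r == Some (idpath i)) =
    (q == idpath i) && (r == idpath i).
  apply/eqP/andP => [|[/eqP-> /eqP->]]; last by rewrite pcomp_idl eqxx.
  have [rq|rq] := eqVneq (ptgt r) (psrc q); last by rewrite pcompN.
  have [u -> Eu] := pcompE rq; case=> ui; move: Eu; rewrite ui /=.
  case: q r rq {ui} => [[y t] tP] [[z s] sP]; rewrite /ptgt /psrc /=.
  case: s sP => // sP; case: t tP => // tP /= zy [zi].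
  by split; apply/eqP/val_inj; rewrite /= -?zy -?zi.
rewrite (bigD1 (idpath i)) //= (bigD1 (idpath i)) //= pcomp_id !eqxx mulr1.
rewrite !big1 ?addr0 // => [q qi|r ri].
  by apply: big1 => r _; rewrite pcomp_id (negPf qi) mulr0.
by rewrite pcomp_id (negPf ri) andbF mulr0.
Qed.

Lemma vscale1 : left_id 1 vscale.
Proof. by move=> x; rewrite /vscale ffunE mul1r. Qed.

Lemma vscaleDr : right_distributive vscale +%R.
Proof. by move=> f x y; rewrite /vscale mulrDr. Qed.

Lemma vscaleDl x : {morph vscale^~ x : f g / f + g}.
Proof. by move=> f g; rewrite /vscale ffunE mulrDl. Qed.

HB.instance Definition _ := GRing.Zmodule_isLmodule.Build
  pathalg (vertex_simple i) vscaleA vscale1 vscaleDr vscaleDl.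

End VertexSimple.

End PathAlgebra.

Section Modules.

Variables (K : fieldType) (A : falgType K).
Implicit Types L M N P D S : lmodType A.

Definition findim M : Prop :=
  exists s : seq M, forall x, exists c : 'I_(size s) -> K,
    x = \sum_i ((c i)%:A : A) *: s`_i.

Definition surjective (X Y : Type) (f : X -> Y) : Prop :=
  forall y, exists x, f x = y.

Definition lmod_iso M N : Prop := exists f : {linear M -> N}, bijective f.

Definition exact_at M N P (f : M -> N) (g : N -> P) : Prop :=
  forall y, g y = 0 <-> exists x, f x = y.

Definition short_exact M N P (f : M -> N) (g : N -> P) : Prop :=
  [/\ injective f, exact_at f g & surjective g].

Definition simple_mod M : Prop :=
  (exists x : M, x != 0) /\
  forall N : submodClosed M,
    (forall x, x \in N -> x = 0) \/ (forall x, x \in N).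

Definition projective P : Prop :=
  forall M N (g : {linear M -> N}) (f : {linear P -> N}), surjective g ->
    exists h : {linear P -> M}, forall x, g (h x) = f x.

Definition projective_cover P M (f : {linear P -> M}) : Prop :=
  [/\ findim P, projective P, surjective f &
    forall N : submodClosed P,
      (forall x, exists2 y, y \in N & f (x - y) = 0) -> forall x, x \in N].

(* M has a finite filtration all of whose subquotients belong to C.            *)
Inductive filtered (C : lmodType A -> Prop) : lmodType A -> Prop :=
| Filtered0 M : (forall x : M, x = 0) -> filtered C M
| FilteredS N M S (f : {linear N -> M}) (g : {linear M -> S}) :
    short_exact f g -> filtered C N -> C S -> filtered C M.

Section Kernel.

Variables (M N : lmodType A) (f : {linear M -> N}).

Definition in_ker : {pred M} := fun x => f x == 0.

Lemma in_ker_submod : submod_closed in_ker.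
Proof.
split=> [|a x y]; rewrite !unfold_in ?linear0 //.
by move=> /eqP fx /eqP fy; rewrite linearP fx fy scaler0 addr0.
Qed.

HB.instance Definition _ := GRing.isSubmodClosed.Build A M in_ker in_ker_submod.

Record lin_ker := LinKer { kerval : M; _ : kerval \in in_ker }.

HB.instance Definition _ := [isSub for kerval].
HB.instance Definition _ := [Choice of lin_ker by <:].
HB.instance Definition _ := [SubChoice_isSubZmodule of lin_ker by <:].
HB.instance Definition _ := [SubZmodule_isSubLmodule of lin_ker by <:].

End Kernel.

Section QuasiHereditary.

Variables (I : finType) (le : rel I) (L : I -> lmodType A).

Definition complete_simples : Prop :=
  [/\ forall i, simple_mod (L i),
      forall i j, lmod_iso (L i) (L j) -> i = j &
      forall S, simple_mod S -> exists i, lmod_iso S (L i)].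

(* Every composition factor of M is isomorphic to some L(j) with j <= i.       *)
Definition factors_le (i : I) M : Prop :=
  filtered (fun S => exists2 j, le j i & lmod_iso S (L j)) M.

Definition largest_quotient (i : I) P D (q : {linear P -> D}) : Prop :=
  [/\ surjective q, factors_le i D &
    forall D' (q' : {linear P -> D'}), surjective q' -> factors_le i D' ->
      exists h : {linear D -> D'}, forall x, h (q x) = q' x].

Definition is_standard (i : I) D : Prop :=
  exists P (p : {linear P -> L i}) (q : {linear P -> D}),
    projective_cover p /\ largest_quotient i q.

Definition quasi_hereditary : Prop :=
  [/\ reflexive le, antisymmetric le, transitive le, complete_simples &
    forall i, exists P D
        (p : {linear P -> L i}) (q : {linear P -> D}) (r : {linear D -> L i}),
      [/\ projective_cover p, largest_quotient i q, forall x, r (q x) = p x,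
          filtered (fun S => exists j, [/\ le i j, i != j & is_standard j S])
            (lin_ker q) &
          filtered (fun S => exists j, [/\ le j i, j != i & lmod_iso S (L j)])
            (lin_ker r)]].

End QuasiHereditary.

Record proj_resolution M := ProjResolution {
  res_mod :> nat -> lmodType A;
  res_d : forall k, {linear res_mod k.+1 -> res_mod k};
  res_aug : {linear res_mod 0 -> M};
  res_findim : forall k, findim (res_mod k);
  res_proj : forall k, projective (res_mod k);
  res_surj : surjective res_aug;
  res_exact0 : exact_at (res_d 0) res_aug;
  res_exact : forall k, exact_at (res_d k.+1) (res_d k) }.

(* Ext^{k+1}(M, N) is the group of cocycles P_{k+1} -> N modulo cohomologous   *)
(* ones, for any projective resolution P of M.                                 *)
Section Ext.

Variables (M N : lmodType A) (P : proj_resolution M) (k : nat).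

Definition cocycle (f : P k.+1 -> N) : Prop :=
  forall x, f (res_d P k.+1 x) = 0.

Definition cohomologous (f f' : P k.+1 -> N) : Prop :=
  exists g : {linear P k -> N}, forall x, f x - f' x = g (res_d P k x).

End Ext.

End Modules.

Local Open Scope quotient_scope.

Section TensorProduct.

Variables (K : fieldType) (A : falgType K) (B : {aspace A}).
Local Notation R := (subvs_of B).

Section Construction.

Variable M : lmodType R.

(* A formal sum of pure tensors is a list of pairs; formal sums are identified *)
(* by the congruence generated by commutativity, biadditivity and B-balance.   *)
Inductive tens_eq : seq (A * M) -> seq (A * M) -> Prop :=
| TensRefl s : tens_eq s s
| TensSym s t : tens_eq s t -> tens_eq t s
| TensTrans s t u : tens_eq s t -> tens_eq t u -> tens_eq s u
| TensCat s s' t t' : tens_eq s s' -> tens_eq t t' -> tens_eq (s ++ t) (s' ++ t')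
| TensComm s t : tens_eq (s ++ t) (t ++ s)
| TensZero m : tens_eq [:: (0, m)] [::]
| TensAddl a a' m : tens_eq [:: (a + a', m)] [:: (a, m); (a', m)]
| TensAddr a m m' : tens_eq [:: (a, m + m')] [:: (a, m); (a, m')]
| TensBal a (b : R) m : tens_eq [:: (a * vsval b, m)] [:: (a, b *: m)].

Definition tens_rel : rel (seq (A * M)) := fun s t => `[< tens_eq s t >].

Lemma tens_rel_refl : reflexive tens_rel.
Proof. by move=> s; apply/asboolP/TensRefl. Qed.

Lemma tens_rel_sym : symmetric tens_rel.
Proof. by move=> s t; apply/asboolP/asboolP; apply: TensSym. Qed.

Lemma tens_rel_trans : transitive tens_rel.
Proof.
by move=> t s u /asboolP st /asboolP tu; apply/asboolP/(TensTrans st tu).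
Qed.

Canonical tens_equiv := EquivRel tens_rel tens_rel_refl tens_rel_sym tens_rel_trans.

Definition tens : Type := {eq_quot tens_equiv}.
HB.instance Definition _ := Choice.on tens.
HB.instance Definition _ := EqQuotient.on tens.

Definition tens_class (s : seq (A * M)) : tens := \pi_tens s.

Definition pure_tensor (a : A) (m : M) : tens := tens_class [:: (a, m)].

Lemma tens_classP s t : tens_class s = tens_class t <-> tens_eq s t.
Proof.
split=> [/eqP|st]; last by apply/eqP; rewrite piE; apply/asboolP.
by rewrite piE => /asboolP.
Qed.

Lemma tens_repr s : tens_eq (repr (tens_class s)) s.
Proof. by apply/tens_classP; rewrite /tens_class reprK. Qed.

Lemma tensW (C : tens -> Prop) : (forall s, C (tens_class s)) -> forall u, C u.
Proof. by move=> Cs u; rewrite -[u]reprK; apply: Cs. Qed.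

Definition tens_zero : tens := tens_class [::].

Definition tens_add (u v : tens) : tens := tens_class (repr u ++ repr v).

Definition tens_act (a : A) (s : seq (A * M)) : seq (A * M) :=
  [seq (a * p.1, p.2) | p <- s].

Definition tens_scale (a : A) (u : tens) : tens := tens_class (tens_act a (repr u)).

Definition tens_opp (u : tens) : tens := tens_scale (-1) u.

Lemma tens_act_eq a s t : tens_eq s t -> tens_eq (tens_act a s) (tens_act a t).
Proof.
elim=> {s t} /=.
- by move=> s; apply: TensRefl.
- by move=> s t _; apply: TensSym.
- by move=> s t u _ st _; apply: TensTrans.
- by move=> s s' t t' _ ss' _ tt'; rewrite /tens_act !map_cat; apply: TensCat.
- by move=> s t; rewrite /tens_act !map_cat; apply: TensComm.
- by move=> m; rewrite mulr0; apply: TensZero.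
- by move=> x y m; rewrite mulrDr; apply: TensAddl.
- by move=> x m m'; apply: TensAddr.
- by move=> x b m; rewrite mulrA; apply: TensBal.
Qed.

Lemma tens_addE s t : tens_add (tens_class s) (tens_class t) = tens_class (s ++ t).
Proof. by apply/tens_classP; apply: TensCat; apply: tens_repr. Qed.

Lemma tens_scaleE a s : tens_scale a (tens_class s) = tens_class (tens_act a s).
Proof. by apply/tens_classP/tens_act_eq/tens_repr. Qed.

Lemma tens_addA : associative tens_add.
Proof.
elim/tensW=> s; elim/tensW=> t; elim/tensW=> u.
by rewrite !tens_addE catA.
Qed.

Lemma tens_addC : commutative tens_add.
Proof.
elim/tensW=> s; elim/tensW=> t; rewrite !tens_addE.
exact/tens_classP/TensComm.
Qed.

Lemma tens_add0 : left_id tens_zero tens_add.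
Proof. by elim/tensW=> s; rewrite tens_addE. Qed.

Lemma tens_act_add a b s : tens_eq (tens_act (a + b) s) (tens_act a s ++ tens_act b s).
Proof.
elim: s => [|[x m] s IHs] /=; first exact: TensRefl.
apply: (@TensTrans _ ([:: (a * x, m); (b * x, m)] ++ (tens_act a s ++ tens_act b s))).
  apply: (@TensCat [:: _] _ (tens_act _ s)) IHs; rewrite mulrDl.
  exact: TensAddl.
apply: (@TensCat [:: _] [:: _]) => /=; first exact: TensRefl.
rewrite -cat1s catA -[_ :: tens_act b s]cat1s [X in tens_eq _ X]catA.
by apply: TensCat; [apply: TensComm | apply: TensRefl].
Qed.

Lemma tens_act0 s : tens_eq (tens_act 0 s) [::].
Proof.
elim: s => [|[x m] s IHs] /=; first exact: TensRefl.
rewrite mul0r; apply: (@TensCat [:: _] [::] _ [::]) IHs; exact: TensZero.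
Qed.

Lemma tens_act1 s : tens_act 1 s = s.
Proof. by rewrite /tens_act -[RHS]map_id; apply: eq_map => -[x m]; rewrite mul1r. Qed.

Lemma tens_addN : left_inverse tens_zero tens_opp tens_add.
Proof.
elim/tensW=> s; rewrite /tens_opp tens_scaleE tens_addE.
apply/tens_classP; apply: TensTrans (tens_act0 s).
apply: TensSym; rewrite -[X in tens_act X](addNr 1).
by rewrite -[X in _ ++ X]tens_act1; apply: tens_act_add.
Qed.

HB.instance Definition _ :=
  GRing.isZmodule.Build tens tens_addA tens_addC tens_add0 tens_addN.

Lemma tens_scaleA a b u : tens_scale a (tens_scale b u) = tens_scale (a * b) u.
Proof.
elim/tensW: u => s; rewrite !tens_scaleE /tens_act -map_comp.
by congr tens_class; apply: eq_map => p /=; rewrite mulrA.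
Qed.

Lemma tens_scale1 : left_id 1 tens_scale.
Proof. by elim/tensW=> s; rewrite tens_scaleE tens_act1. Qed.

Lemma tens_scaleDr : right_distributive tens_scale +%R.
Proof.
move=> a; elim/tensW=> s; elim/tensW=> t.
by rewrite [_ + _]tens_addE !tens_scaleE [RHS]tens_addE /tens_act map_cat.
Qed.

Lemma tens_scaleDl u : {morph tens_scale^~ u : a b / a + b}.
Proof.
move=> a b; elim/tensW: u => s; rewrite !tens_scaleE [RHS]tens_addE.
exact/tens_classP/tens_act_add.
Qed.

HB.instance Definition _ := GRing.Zmodule_isLmodule.Build A tens
  tens_scaleA tens_scale1 tens_scaleDr tens_scaleDl.

End Construction.

Section Functor.

Variables (M N : lmodType R) (f : {linear M -> N}).

Definition tens_map_seq (s : seq (A * M)) : seq (A * N) :=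
  [seq (p.1, f p.2) | p <- s].

Definition tens_map (u : tens M) : tens N := tens_class (tens_map_seq (repr u)).

Lemma tens_map_eq s t : tens_eq s t -> tens_eq (tens_map_seq s) (tens_map_seq t).
Proof.
elim=> {s t} /=.
- by move=> s; apply: TensRefl.
- by move=> s t _; apply: TensSym.
- by move=> s t u _ st _; apply: TensTrans.
- by move=> s s' t t' _ ss' _ tt'; rewrite /tens_map_seq !map_cat; apply: TensCat.
- by move=> s t; rewrite /tens_map_seq !map_cat; apply: TensComm.
- by move=> m; apply: TensZero.
- by move=> x y m; apply: TensAddl.
- by move=> x m m'; rewrite linearD; apply: TensAddr.
- by move=> x b m; rewrite linearZ; apply: TensBal.
Qed.

Lemma tens_mapE s : tens_map (tens_class s) = tens_class (tens_map_seq s).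
Proof. by apply/tens_classP/tens_map_eq/tens_repr. Qed.

Lemma tens_map_pure a m : tens_map (pure_tensor a m) = pure_tensor a (f m).
Proof. exact: tens_mapE. Qed.

Lemma tens_map_linear : linear tens_map.
Proof.
move=> a; elim/tensW=> s; elim/tensW=> t.
rewrite [a *: _]tens_scaleE [_ + _]tens_addE !tens_mapE.
rewrite [a *: _]tens_scaleE [RHS]tens_addE /tens_map_seq map_cat.
by rewrite /tens_act -!map_comp.
Qed.

HB.instance Definition _ :=
  GRing.isLinear.Build A (tens M) (tens N) *:%R tens_map tens_map_linear.

End Functor.

Definition tens_exact : Prop :=
  forall (M N P : lmodType R) (f : {linear M -> N}) (g : {linear N -> P}),
    findim M -> findim N -> findim P ->
    short_exact f g -> short_exact (tens_map f) (tens_map g).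

(* The map Ext_B^{k+1}(M, N) -> Ext_A^{k+1}(A (x)_B M, A (x)_B N) induced by   *)
(* the exact functor A (x)_B -, computed with projective resolutions P of M    *)
(* and Q of A (x)_B M: it sends the class of f to the class of (A (x) f) o c,  *)
(* where c : Q -> A (x)_B P is a chain map lifting the identity.               *)
Definition tens_ext_iso (M N : lmodType R) (k : nat) : Prop :=
  forall (P : proj_resolution M) (Q : proj_resolution (tens M))
      (c : forall m, {linear Q m -> tens (P m)}),
    (forall x, tens_map (res_aug P) (c 0%N x) = res_aug Q x) ->
    (forall m x, tens_map (res_d P m) (c m.+1 x) = c m (res_d Q m x)) ->
    let ext_map (f : {linear P k.+1 -> N}) x := tens_map f (c k.+1 x) in
    (forall f f' : {linear P k.+1 -> N}, cocycle f -> cocycle f' ->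
       cohomologous (ext_map f) (ext_map f') -> cohomologous f f') /\
    (forall g : {linear Q k.+1 -> tens N}, cocycle g ->
       exists2 f : {linear P k.+1 -> N},
         cocycle f & cohomologous (ext_map f) g).

End TensorProduct.

Section Borel.

Variables (K : fieldType) (A : falgType K) (I : finType) (le : rel I).
Variables (L : I -> lmodType A) (B : {aspace A}).

(* An {aspace A} may have a unit different from that of A, hence the condition *)
(* 1 \in B.                                                                    *)
Definition exact_borel (LB : I -> lmodType (subvs_of B)) : Prop :=
  [/\ 1 \in B, quasi_hereditary le LB,
      forall i D, is_standard le LB i D -> simple_mod D,
      tens_exact B &
      forall i, exists2 D, is_standard le L i D & lmod_iso (tens (LB i)) D].

Definition regular_exact_borel : Prop :=
  exists LB : I -> lmodType (subvs_of B),
    exact_borel LB /\ forall k i j, tens_ext_iso (LB i) (LB j) k.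

End Borel.

(* Main.v *)
(* In the path algebra A of 0 -> 1 -> ... -> n, the standard module at m is    *)
(* supported on the interval of those j >= m with j <=_T m. For B take the     *)
(* span of the paths i -> m with i <=_T m. Every interval [i, j] has a largest *)
(* vertex m for <=_T (the lowest common ancestor), so i -> j factors uniquely  *)
(* as a path i -> m in B followed by m -> j with j in the support of the       *)
(* standard module at m. Hence, as a right B-module, A is the direct sum over  *)
(* these paths m -> j of copies of e_m B: it is projective, A (x)_B - is exact *)
(* and A (x)_B L_B(m) is the standard module at m.                             *)
(* B is again hereditary: the radical of B e_i is zero or B e_t, where t is    *)
(* the first ancestor of i beyond i. So Ext^k vanishes on both sides for       *)
(* k > 1, and Ext^1 is compared on the resolution B e_t -> B e_i of L_B(i),    *)
(* where only the components of the standard modules at t and i matter.        *)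

Require Import Defs.
From HB Require Import structures.
From mathcomp Require Import all_boot all_order all_algebra all_field.
From mathcomp Require Import boolp zify ring.

Set Implicit Arguments.
Unset Strict Implicit.
Unset Printing Implicit Defensive.

Import GRing.Theory.
Local Open Scope ring_scope.

(** * Modules, lifting and comparison of resolutions *)

(** Both algebras are treated as algebras of matrices supported on a relation ([incidence_model]):
    all pairs [i <= j] for the path algebra ([pathalg_incidence]), those with moreover [i <=_T j]
    for B ([borel_incidence]). One criterion, [incidence_quasi_hereditary], therefore serves both.
    It asks that the kernel of P(i) -> Delta(i) be zero or P(t) for a single vertex t. Since
    subtrees carry intervals of labels, t can be taken to be the least vertex after i that is not
    below i in the tree order ([le_next]), and the same t works for A and for B.

    Exactness rests on the largest vertex m of an interval [i, j]. Its existence and uniqueness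
    ([tree_le_lca], [lca_unique]) give a dual basis of A as a right B-module ([dual_formE]). The
    resulting coordinates on A (x)_B M show that tensoring is exact, and they compute the kernel of
    A e_i -> A (x)_B L_B(i) as that of P(i) -> Delta(i) ([std_map_ker]).

    For regularity, [tens_ext_iso_length_one] replaces arbitrary resolutions by a short one, here B
    e_t -> B e_i -> L_B(i), and leaves Ext^1 to [borel_ext]. A map A (x)_B B e_t -> Delta(j) is an
    element z of e_t Delta(j). If j = t, it comes from L_B(j), and no nonzero such map is a
    coboundary because Delta(t) vanishes at i < t. If j differs from t and z is nonzero, then j <=
    i, and z comes from e_i Delta(j) along the path i -> t, so its class is zero. *)

Section LinearMaps.

Variables (K : fieldType) (A : falgType K).
Implicit Types L M N P D S : lmodType A.

Lemma linear_of M N (f : M -> N) : (forall a x y, f (a *: x + y) = a *: f x + f y) ->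
  exists g : {linear M -> N}, g =1 f.
Proof.
move=> fL.
pose m := GRing.isLinear.Build A M N *:%R f fL.
pose g : {linear M -> N} := HB.pack f m.
by exists g.
Qed.

Lemma factor_through M N P (q : {linear M -> N}) (f : {linear M -> P}) :
  Defs.surjective q -> (forall x, q x = 0 -> f x = 0) ->
  exists h : {linear N -> P}, forall x, h (q x) = f x.
Proof.
move=> qs qf; have [s sP] := choice qs.
have wd x y : q x = q y -> f x = f y.
  move=> qxy; apply/eqP; rewrite -subr_eq0 -linearB; apply/eqP/qf.
  by rewrite linearB qxy subrr.
have [a x y|h hE] := @linear_of N P (f \o s).
  by rewrite /= -linearP; apply: wd; rewrite linearP !sP.
by exists h => x; rewrite hE /=; apply: wd; rewrite sP.
Qed.

(** By exactness [d] is onto the kernel of [d'], and [f] lands in this kernel; projectivity is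
    applied to the two corestrictions. *)
Lemma lift_exact P M N N' (d : {linear M -> N}) (d' : {linear N -> N'})
    (f : {linear P -> N}) : projective P -> exact_at d d' ->
  (forall x, d' (f x) = 0) -> exists h : {linear P -> M}, forall x, d (h x) = f x.
Proof.
move=> prP dd' d'f0.
have dker x : d x \in in_ker d' by rewrite unfold_in; apply/eqP/(dd' _).2; exists x.
have fker x : f x \in in_ker d' by rewrite unfold_in; apply/eqP/d'f0.
have [a x y|dk dkE] := @linear_of M (lin_ker d') (fun x => LinKer (dker x)).
  by apply: val_inj; rewrite [LHS]linearP.
have [a x y|fk fkE] := @linear_of P (lin_ker d') (fun x => LinKer (fker x)).
  by apply: val_inj; rewrite [LHS]linearP.
have [|h hE] := prP _ _ dk fk.
  case=> y yk; have /eqP/(dd' y).1[x xy] := yk.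
  by exists x; rewrite dkE; apply: val_inj.
exists h => x; have := hE x; rewrite dkE fkE => /(congr1 val) /=; exact.
Qed.

Definition in_image M N (f : {linear M -> N}) : {pred N} := fun y => `[< exists x, f x = y >].

Lemma in_image_submod M N (f : {linear M -> N}) : submod_closed (in_image f).
Proof.
split=> [|a x y]; rewrite !unfold_in; first by apply/asboolP; exists 0; apply: linear0.
move=> /asboolP[x' <-] /asboolP[y' <-]; apply/asboolP; exists (a *: x' + y').
exact: linearP.
Qed.

HB.instance Definition _ M N (f : {linear M -> N}) :=
  GRing.isSubmodClosed.Build A N (in_image f) (in_image_submod f).

Lemma in_imageP M N (f : {linear M -> N}) y : reflect (exists x, f x = y) (y \in in_image f).
Proof. exact: asboolP. Qed.

Lemma lmod_iso_refl M : lmod_iso M M.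
Proof. by exists idfun; exists idfun. Qed.

Lemma lmod_iso_sym M N : lmod_iso M N -> lmod_iso N M.
Proof.
case=> f [g fK gK].
have [a x y|h hE] := @linear_of N M g.
  by apply: (can_inj fK); rewrite linearP !gK.
by exists h; exists f => x; rewrite hE.
Qed.

Lemma lmod_iso_of M N (f : {linear M -> N}) :
  (forall x, f x = 0 -> x = 0) -> Defs.surjective f -> lmod_iso M N.
Proof.
move=> f0 fs; have [g gP] := choice fs.
exists f; exists g => // x; apply/eqP; rewrite -subr_eq0; apply/eqP/f0.
by rewrite linearB gP subrr.
Qed.

(** Only the last step of the filtration has to be transported, by composing its two maps with the
    isomorphism. *)
Lemma filtered_iso (C : lmodType A -> Prop) M N :
  lmod_iso M N -> filtered C M -> filtered C N.
Proof.
move=> MN fM; case: fM MN => [M' M0|M' N' S i p [ii ip ps] fN' CS].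
  move=> /lmod_iso_sym[f [g fK gK]].
  by apply: Filtered0 => x; apply: (can_inj fK); rewrite (M0 (f x)) linear0.
move=> /lmod_iso_sym[f [g fK gK]].
have [a x y|g' g'E] := @linear_of N' N g.
  by apply: (can_inj fK); rewrite linearP !gK.
apply: (@FilteredS _ _ _ _ _ _ (g' \o i) (p \o f)) CS => //; split.
- by move=> x y /=; rewrite !g'E => /(can_inj gK)/ii.
- move=> y /=; split=> [/(ip _).1[x xy]|[x <-]].
    by exists x; rewrite /= g'E xy fK.
  by rewrite /= g'E gK; apply/(ip _).2; exists x.
- by move=> y; have [x xy] := ps y; exists (g' x); rewrite /= g'E gK.
Qed.

Lemma simple_mod_iso M N : lmod_iso M N -> simple_mod M -> simple_mod N.
Proof.
case=> f [g fK gK] [[x x0] sM]; split.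
  by exists (f x); rewrite -(linear0 f) (can_eq fK).
move=> X; pose Y : {pred M} := fun x => f x \in X.
have YE z : (z \in Y) = (f z \in X) by [].
have Ysub : submod_closed Y.
  split=> [|a u v]; rewrite !YE ?linear0 ?rpred0 //.
  by move=> uX vX; rewrite linearP rpredD ?rpredZ.
pose m := GRing.isSubmodClosed.Build A M Y Ysub.
pose Z : submodClosed M := HB.pack Y m.
have [Z0|Z1] := sM Z; [left=> y yX|right=> y].
  rewrite -(gK y) (Z0 (g y)) ?linear0 //.
  by rewrite -[_ \in _]/(g y \in Y) YE gK.
by have := Z1 (g y); rewrite -[_ \in _]/(g y \in Y) YE gK.
Qed.

Lemma exact_comp0 M N P (f : {linear M -> N}) (g : {linear N -> P}) :
  exact_at f g -> forall x, g (f x) = 0.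
Proof. by move=> fg x; apply/(fg _).2; exists x. Qed.

Lemma inj_exact0 M N (f : {linear M -> N}) x : injective f -> f x = 0 -> x = 0.
Proof. by move=> fi fx; apply: fi; rewrite linear0. Qed.

End LinearMaps.

Section Comparison.

Variables (K : fieldType) (A : falgType K).
Implicit Types M N X Y : lmodType A.

Lemma comparison M N X0 X1 Y0 Y1 (m : {linear M -> N})
    (d : {linear X1 -> X0}) (e : {linear X0 -> M})
    (d' : {linear Y1 -> Y0}) (e' : {linear Y0 -> N}) :
  projective X0 -> projective X1 -> (forall x, e (d x) = 0) ->
  Defs.surjective e' -> exact_at d' e' ->
  exists (a0 : {linear X0 -> Y0}) (a1 : {linear X1 -> Y1}),
    (forall x, e' (a0 x) = m (e x)) /\ (forall x, d' (a1 x) = a0 (d x)).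
Proof.
move=> pX0 pX1 ed e's d'e'.
have [a0 a0E] := pX0 _ _ e' (m \o e) e's.
have [x|a1 a1E] := lift_exact (f := a0 \o d) pX1 d'e'.
  by rewrite /= a0E /= ed linear0.
by exists a0, a1.
Qed.

(** Only the first homotopy is built. In degree one the error is merely placed in the image of [d2];
    this suffices against cocycles, which kill that image. *)
Lemma homotopy M N X0 X1 Y0 Y1 Y2 (m : {linear M -> N})
    (d : {linear X1 -> X0}) (e : {linear X0 -> M})
    (d2 : {linear Y2 -> Y1}) (d' : {linear Y1 -> Y0}) (e' : {linear Y0 -> N})
    (a0 b0 : {linear X0 -> Y0}) (a1 b1 : {linear X1 -> Y1}) :
  projective X0 -> exact_at d' e' -> exact_at d2 d' ->
  (forall x, e' (a0 x) = m (e x)) -> (forall x, d' (a1 x) = a0 (d x)) ->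
  (forall x, e' (b0 x) = m (e x)) -> (forall x, d' (b1 x) = b0 (d x)) ->
  exists h : {linear X0 -> Y1},
    (forall x, d' (h x) = a0 x - b0 x) /\
    forall x, exists y, a1 x - b1 x - h (d x) = d2 y.
Proof.
move=> pX0 d'e' d2d' a0E a1E b0E b1E.
have [x|h hE] := lift_exact (f := a0 \- b0) pX0 d'e'.
  by rewrite /= linearB a0E b0E subrr.
exists h; split=> [x|x]; first by rewrite hE.
have [|y yE] := (d2d' (a1 x - b1 x - h (d x))).1; last by exists y.
by rewrite !linearB hE a1E b1E /= subrr.
Qed.

End Comparison.

(** * Vanishing of higher Ext in the presence of a resolution of length one *)

Section LengthOne.

Variables (K : fieldType) (A : falgType K) (M X0 X1 : lmodType A).
Variables (d : {linear X1 -> X0}) (e : {linear X0 -> M}).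
Hypotheses (dexact : short_exact d e) (pX0 : projective X0) (pX1 : projective X1).

(** The image of [res_d P k.+1] is a direct summand, with projection [res_d P k.+1 \o s]. To start,
    the round trip from [P] through the short resolution is homotopic to the identity, and its part
    [b1] vanishes on the image because [d] is injective. *)
Lemma length_one_split (P : proj_resolution M) k :
  exists s : {linear P k.+1 -> P k.+2},
    forall x, res_d P k.+1 (s (res_d P k.+1 x)) = res_d P k.+1 x.
Proof.
case: dexact => di de es.
elim: k => [|k [s sE]].
  have [a0 [a1 [a0E a1E]]] := comparison idfun pX0 pX1 (exact_comp0 de)
    (@res_surj _ _ _ P) (@res_exact0 _ _ _ P).
  have [b0 [b1 [b0E b1E]]] := comparison idfun (@res_proj _ _ _ P 0)
    (@res_proj _ _ _ P 1) (exact_comp0 (@res_exact0 _ _ _ P)) es de.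
  have [||||h [hE hE']] := @homotopy _ _ _ _ _ _ _ _ _ idfun (res_d P 0) (res_aug P)
      (res_d P 1) (res_d P 0) (res_aug P) idfun (a0 \o b0) idfun (a1 \o b1)
      (@res_proj _ _ _ P 0) (@res_exact0 _ _ _ P) (@res_exact _ _ _ P 0) => //.
  - by move=> x /=; rewrite a0E /= b0E.
  - by move=> x /=; rewrite a1E b1E.
  have [x|s sE] := lift_exact (f := (idfun \- (a1 \o b1)) \- (h \o res_d P 0))
      (@res_proj _ _ _ P 1) (@res_exact _ _ _ P 0).
    by have [y /= ->] := hE' x; apply: (exact_comp0 (@res_exact _ _ _ P 0)).
  exists s => x; rewrite sE /= (exact_comp0 (@res_exact _ _ _ P 0)) linear0 subr0.
  suff -> : b1 (res_d P 1 x) = 0 by rewrite linear0 subr0.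
  apply: (inj_exact0 di).
  by rewrite b1E (exact_comp0 (@res_exact _ _ _ P 0)) linear0.
(* The identity minus [s \o res_d P k.+1] has values in the kernel of the differential, so it lifts
   along the next one; the lift is the next splitting. *)
have [x|t tE] := lift_exact (f := idfun \- (s \o res_d P k.+1))
    (@res_proj _ _ _ P k.+2) (@res_exact _ _ _ P k.+1).
  by rewrite /= linearB sE subrr.
exists t => x; rewrite tE /= (exact_comp0 (@res_exact _ _ _ P k.+1)) linear0.
by rewrite subr0.
Qed.

(** Ext vanishes above degree one: with [s] the splitting, [x - s (d x)] is a boundary, hence killed
    by [f]. *)
Lemma length_one_coboundary (P : proj_resolution M) (N : lmodType A) k (f : {linear P k.+2 -> N}) :
  cocycle f -> exists g : {linear P k.+1 -> N}, forall x, f x = g (res_d P k.+1 x).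
Proof.
move=> fc; have [s sE] := length_one_split P k.
exists (f \o s) => x; apply/eqP; rewrite -subr_eq0 -linearB.
have [|y <-] := (@res_exact _ _ _ P k.+1 (x - s (res_d P k.+1 x))).1.
  by rewrite linearB sE subrr.
by rewrite fc.
Qed.

End LengthOne.

(** * Projective left ideals generated by idempotents *)

Section CyclicProjective.

Variables (K : fieldType) (A : falgType K).
Implicit Types (M N : lmodType A) (e : A).

Definition rmul (a : A) : A^o -> A^o := fun x => (x : A) * a.

Lemma rmul_linear a : linear (rmul a).
Proof. by move=> b x y; rewrite /rmul mulrDl -mulrA. Qed.

HB.instance Definition _ a := GRing.isLinear.Build A A^o A^o *:%R (rmul a) (rmul_linear a).

(* [idmod e] is the left ideal [A e] when [e] is idempotent. *)
Definition idmod e : lmodType A := lin_ker (rmul (1 - e)).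

Definition idval e (x : idmod e) : A := kerval x.
Arguments idval : simpl never.

Lemma idval_inj e : injective (@idval e).
Proof. exact: val_inj. Qed.

Lemma idvalP e (x : idmod e) : idval x * e = idval x.
Proof.
have /eqP : idval x * (1 - e) = 0 by apply/eqP; apply: (valP x).
by rewrite mulrBr mulr1 subr_eq0 => /eqP.
Qed.

Lemma idvalZ e a (x : idmod e) : idval (a *: x) = a * idval x.
Proof. by []. Qed.

Lemma idvalD e (x y : idmod e) : idval (x + y) = idval x + idval y.
Proof. by []. Qed.

Lemma idmod_of e a : a * e = a -> {x : idmod e | idval x = a}.
Proof.
move=> ae; have ak : (a : A^o) \in in_ker (rmul (1 - e)).
  apply/eqP; change (a * (1 - e) = 0); by rewrite mulrBr mulr1 ae subrr.
by exists (LinKer ak).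
Qed.

Lemma idmod_map M (e : A) (w : M) :
  exists f : {linear idmod e -> M}, forall x, f x = idval x *: w.
Proof.
have [a x y|f fE] := @linear_of _ _ (idmod e) M (fun x => idval x *: w).
  by rewrite idvalD idvalZ scalerDl scalerA.
by exists f.
Qed.

Lemma idmod_linE e M (f : {linear idmod e -> M}) (g x : idmod e) :
  idval g = e -> f x = idval x *: f g.
Proof.
move=> ge; rewrite -linearZ; congr (f _); apply: idval_inj.
by rewrite idvalZ ge idvalP.
Qed.

Lemma idmod_projective e : e * e = e -> projective (idmod e).
Proof.
move=> ee M N g f gs; have [x0 x0e] := idmod_of ee.
have [w wE] := gs (f x0); have [h hE] := idmod_map e w.
by exists h => x; rewrite hE linearZ wE (idmod_linE f x x0e).
Qed.

Lemma algZE (k : K) (a : A) : (k%:A : A) * a = k *: a.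
Proof. by rewrite -scalerAl mul1r. Qed.

Lemma idmod_findim e : e * e = e -> findim (idmod e).
Proof.
move=> ee; pose b := vbasis (fullv : {vspace A}).
have be (a : A) : (a * e) * e = a * e by rewrite -mulrA ee.
exists [seq sval (idmod_of (be a)) | a <- b] => x.
have sz : size [seq sval (idmod_of (be a)) | a <- b] = \dim (fullv : {vspace A}).
  by rewrite size_map size_tuple.
exists (fun i => coord b (cast_ord sz i) (idval x)).
apply: idval_inj.
rewrite -[LHS]idvalP {1}(coord_vbasis (memvf (idval x))) mulr_suml.
have idsum (I : Type) (r : seq I) (F : I -> idmod e) :
    idval (\sum_(i <- r) F i) = \sum_(i <- r) idval (F i).
  by apply: (big_morph _ (@idvalD e)).
rewrite idsum (reindex (cast_ord sz)) /=; last first.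
  by exists (cast_ord (esym sz)) => i _; rewrite ?cast_ordK ?cast_ordKV.
apply: eq_bigr => i _. rewrite idvalZ algZE -scalerAl; congr (_ *: _).
rewrite (nth_map 0); last by have := ltn_ord i; rewrite {2}size_map.
by case: (idmod_of _) => y /= ->.
Qed.

End CyclicProjective.

(** * Tensor products *)

Section Tensor.

Variables (K : fieldType) (A : falgType K) (B : {aspace A}).
Local Notation R := (subvs_of B).
Implicit Types M N P X : lmodType R.

Lemma tens_class_cons M p (s : seq (A * M)) :
  tens_class (p :: s) = pure_tensor p.1 p.2 + tens_class s.
Proof. by rewrite [RHS]tens_addE; case: p. Qed.

Lemma tens_ind M (C : tens M -> Prop) : C 0 ->
  (forall a m u, C u -> C (pure_tensor a m + u)) -> forall u, C u.
Proof.
move=> C0 Cp; elim/tensW; elim=> [|p s IHs]; first exact: C0.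
by rewrite tens_class_cons; apply: Cp.
Qed.

Lemma pure_scale M (a b : A) (m : M) : a *: pure_tensor b m = pure_tensor (a * b) m.
Proof. exact: tens_scaleE. Qed.

Lemma pure_addl M (a b : A) (m : M) :
  pure_tensor (a + b) m = pure_tensor a m + pure_tensor b m.
Proof. by rewrite [RHS]tens_addE; apply/tens_classP/TensAddl. Qed.

Lemma pure_addr M (a : A) (m m' : M) :
  pure_tensor a (m + m') = pure_tensor a m + pure_tensor a m'.
Proof. by rewrite [RHS]tens_addE; apply/tens_classP/TensAddr. Qed.

Lemma pure_bal M (a : A) (b : R) (m : M) :
  pure_tensor (a * vsval b) m = pure_tensor a (b *: m).
Proof. exact/tens_classP/TensBal. Qed.

Lemma pure1Z M (b : R) (m : M) : pure_tensor 1 (b *: m) = vsval b *: pure_tensor 1 m.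
Proof. by rewrite -pure_bal mul1r pure_scale mulr1. Qed.

Lemma pure0r M (a : A) : pure_tensor a (0 : M) = 0.
Proof. by apply: (addrI (pure_tensor a 0)); rewrite -pure_addr !addr0. Qed.

(** The target is only an abelian group, so that this also defines the coordinates of
    [dual_basis_coord], which go to a module over [R]. *)
Lemma tens_lift M (G : zmodType) (b : A -> M -> G) :
  (forall a a' m, b (a + a') m = b a m + b a' m) ->
  (forall a m m', b a (m + m') = b a m + b a m') ->
  (forall a (r : R) m, b (a * vsval r) m = b a (r *: m)) ->
  exists F : tens M -> G,
    {morph F : x y / x + y} /\ forall a m, F (pure_tensor a m) = b a m.
Proof.
move=> bDl bDr bal; pose Fs (s : seq (A * M)) := \sum_(p <- s) b p.1 p.2.
have b0 m : b 0 m = 0 by apply: (addrI (b 0 m)); rewrite -bDl !addr0.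
have Fs_eq s t : tens_eq s t -> Fs s = Fs t.
  elim=> {s t} //=.
  - by move=> s t u _ -> _ ->.
  - by move=> s s' t t' _ ss' _ tt'; rewrite /Fs !big_cat /= -/(Fs s) -/(Fs t) ss' tt'.
  - by move=> s t; rewrite /Fs !big_cat /= addrC.
  - by move=> m; rewrite /Fs big_seq1 big_nil b0.
  - by move=> a a' m; rewrite /Fs big_seq1 big_cons big_seq1 bDl.
  - by move=> a m m'; rewrite /Fs big_seq1 big_cons big_seq1 bDr.
  - by move=> a r m; rewrite /Fs !big_seq1 bal.
have FE s : Fs (generic_quotient.repr (tens_class s)) = Fs s by apply/Fs_eq/tens_repr.
exists (fun u => Fs (generic_quotient.repr u)); split.
  elim/tensW=> s; elim/tensW=> t; rewrite [_ + _]tens_addE !FE.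
  by rewrite /Fs big_cat.
by move=> a m; rewrite FE /Fs big_seq1.
Qed.

Lemma tens_lift_linear M (N : lmodType A) (b : A -> M -> N) :
  (forall a a' m, b (a + a') m = b a m + b a' m) ->
  (forall a m m', b a (m + m') = b a m + b a m') ->
  (forall a (r : R) m, b (a * vsval r) m = b a (r *: m)) ->
  (forall a a' m, b (a * a') m = a *: b a' m) ->
  exists F : {linear tens M -> N}, forall a m, F (pure_tensor a m) = b a m.
Proof.
move=> bDl bDr bal bZ; have [F [FD Fp]] := tens_lift bDl bDr bal.
have F0 : F 0 = 0 by apply: (addrI (F 0)); rewrite -FD !addr0.
have FZ a u : F (a *: u) = a *: F u.
  elim/tens_ind: u => [|a' m u IHu]; first by rewrite scaler0 F0 scaler0.
  by rewrite scalerDr !FD IHu scalerDr pure_scale !Fp bZ.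
have [a x y|F' F'E] := @linear_of _ _ (tens M) N F; first by rewrite FD FZ.
by exists F' => a m; rewrite F'E.
Qed.

Lemma tens_lin_eq M (N : lmodType A) (f g : {linear tens M -> N}) :
  (forall m, f (pure_tensor 1 m) = g (pure_tensor 1 m)) -> f =1 g.
Proof.
move=> fg; elim/tens_ind=> [|a m u IHu]; first by rewrite !linear0.
by rewrite !linearD IHu -[a]mulr1 -pure_scale !linearZ /= fg.
Qed.

Lemma tens_map_comp M N P (f : {linear N -> P}) (g : {linear M -> N}) (h : {linear M -> P}) :
  (forall x, h x = f (g x)) -> forall u, @tens_map _ _ B _ _ h u = tens_map f (tens_map g u).
Proof.
move=> hE; pose fg := @tens_map _ _ B _ _ f \o @tens_map _ _ B _ _ g.
by apply: (@tens_lin_eq _ _ _ fg) => m; rewrite /fg /= !tens_map_pure hE.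
Qed.

Lemma tens_map_ext M N (f g : {linear M -> N}) : f =1 g -> @tens_map _ _ B _ _ f =1 tens_map g.
Proof. by move=> fg; apply: tens_lin_eq => m; rewrite /= !tens_map_pure fg. Qed.

Lemma tens_map_sub M N (f g h : {linear M -> N}) :
  (forall x, h x = f x - g x) ->
  forall u, @tens_map _ _ B _ _ h u = tens_map f u - tens_map g u.
Proof.
move=> hE; pose fg := @tens_map _ _ B _ _ f \- @tens_map _ _ B _ _ g.
apply: (@tens_lin_eq _ _ _ fg) => m; rewrite /fg /= !tens_map_pure hE.
by rewrite pure_addr -[X in _ + X](addKr (pure_tensor 1 (g m))) -pure_addr subrr pure0r addr0.
Qed.

Lemma tens_map_eq0 M N (f : {linear M -> N}) :
  (forall x, f x = 0) -> forall u, @tens_map _ _ B _ _ f u = 0.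
Proof.
move=> f0; apply: (@tens_lin_eq _ _ _ \0) => m.
by rewrite /= tens_map_pure f0 pure0r.
Qed.

Lemma tens_map_surj M N (f : {linear M -> N}) :
  Defs.surjective f -> Defs.surjective (@tens_map _ _ B _ _ f).
Proof.
move=> fs; elim/tens_ind => [|a m x [y <-]]; first by exists 0; rewrite linear0.
have [m' <-] := fs m; exists (pure_tensor a m' + y).
by rewrite linearD /= tens_map_pure.
Qed.

(** * Flatness from a dual basis *)

Section Flat.

Variables (I : finType) (u : I -> A) (p : I -> A -> R).
Hypotheses (pD : forall t, {morph p t : a b / a + b})
  (pM : forall t a (b : R), p t (a * vsval b) = p t a * b)
  (puE : forall a, a = \sum_t u t * vsval (p t a)).

(** The [u t] and [p t] form a dual basis, making [A] a finitely generated projective right module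
    over [B]. The coordinate [c t] is [p t] tensored with [M], followed by the identification of B
    (x)_B M with M. *)
Lemma dual_basis_coord M : exists c : I -> tens M -> M,
  [/\ forall t, {morph c t : x y / x + y},
      forall t a m, c t (pure_tensor a m) = p t a *: m &
      forall x, x = \sum_t pure_tensor (u t) (c t x)].
Proof.
have /choice[c cP] : forall t, exists c : tens M -> M,
    {morph c : x y / x + y} /\ forall a m, c (pure_tensor a m) = p t a *: m.
  move=> t; apply: tens_lift => [a a' m|a m m'|a r m].
  - by rewrite pD scalerDl.
  - by rewrite scalerDr.
  - by rewrite pM scalerA.
exists c; split=> [t|t|]; try by have [] := cP t.
elim/tens_ind => [|a m x IHx].
  rewrite big1 // => t _; have [cD _] := cP t.
  have -> : c t 0 = 0 by apply: (addrI (c t 0)); rewrite -cD !addr0.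
  exact: pure0r.
rewrite {1}IHx.
under [RHS]eq_bigr => t _ do rewrite (cP t).1 pure_addr (cP t).2 -pure_bal.
rewrite big_split /=; congr (_ + _).
rewrite {1}[a]puE; apply: (big_ind2 (fun x y => pure_tensor x m = y)) => //.
  by apply/tens_classP/TensZero.
by move=> x1 x2 y1 y2 <- <-; apply: pure_addl.
Qed.

Lemma dual_basis_coord_nat M N (f : {linear M -> N}) (c : I -> tens M -> M)
    (c' : I -> tens N -> N) t :
  {morph c t : x y / x + y} -> {morph c' t : x y / x + y} ->
  (forall a m, c t (pure_tensor a m) = p t a *: m) ->
  (forall a m, c' t (pure_tensor a m) = p t a *: m) ->
  forall x, c' t (tens_map f x) = f (c t x).
Proof.
move=> cD c'D cp c'p.
have c0 : c t 0 = 0 by apply: (addrI (c t 0)); rewrite -cD !addr0.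
have c'0 : c' t 0 = 0 by apply: (addrI (c' t 0)); rewrite -c'D !addr0.
elim/tens_ind => [|a m x IHx]; first by rewrite linear0 c0 c'0 linear0.
by rewrite linearD c'D IHx cD linearD /= tens_map_pure cp c'p linearZ.
Qed.

Lemma dual_basis_inj M N (f : {linear M -> N}) :
  injective f -> injective (@tens_map _ _ B _ _ f).
Proof.
move=> fi; have [c [cD cp cE]] := dual_basis_coord M.
have [c' [c'D c'p c'E]] := dual_basis_coord N.
move=> x y fxy; rewrite [x]cE [y]cE; apply: eq_bigr => t _; congr (pure_tensor _ _).
apply: fi; have cn := dual_basis_coord_nat f (cD t) (c'D t) (cp t) (c'p t).
by rewrite -!cn fxy.
Qed.

(** Coordinates are natural, so those of a tensor in the kernel lie in the kernel of [g]; they are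
    lifted along [f] one by one. *)
Lemma dual_basis_exact M N P (f : {linear M -> N}) (g : {linear N -> P}) :
  exact_at f g -> exact_at (@tens_map _ _ B _ _ f) (@tens_map _ _ B _ _ g).
Proof.
move=> fg; have [c [cD cp cE]] := dual_basis_coord N.
have [c' [c'D c'p c'E]] := dual_basis_coord P.
have [a' [a'D a'p a'E]] := dual_basis_coord M.
move=> y; split=> [gy|[x <-]]; last first.
  rewrite -(@tens_map_comp _ _ _ g f (g \o f)) //; apply: tens_map_eq0 => z.
  exact: exact_comp0.
have /choice[x xE] : forall t, exists x, f x = c t y.
  move=> t; apply/(fg _).1.
  rewrite -(dual_basis_coord_nat g (cD t) (c'D t) (cp t) (c'p t)) gy.
  by apply: (addrI (c' t 0)); rewrite -c'D !addr0.
exists (\sum_t pure_tensor (u t) (x t)).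
rewrite [RHS]cE linear_sum; apply: eq_bigr => t _.
by rewrite /= tens_map_pure xE.
Qed.

Lemma dual_basis_tens_exact : tens_exact B.
Proof.
move=> M N P f g _ _ _ [fi fg gs]; split.
- exact: dual_basis_inj.
- exact: dual_basis_exact.
- exact: tens_map_surj.
Qed.

End Flat.

Section Restriction.

Hypothesis B1 : 1 \in B.

(** The type mentions [B1] so that its module structure may use that [B] and [A] share their
    unit. *)
Definition restr (M : lmodType A) : Type := let _ := B1 in M.

Section RestrLmod.

Variable M : lmodType A.

HB.instance Definition _ := GRing.Zmodule.on (restr M).

Definition restr_scale (b : R) (x : restr M) : restr M := vsval b *: (x : M).

Lemma restr_scaleA a b x : restr_scale a (restr_scale b x) = restr_scale (a * b) x.
Proof. by rewrite /restr_scale scalerA. Qed.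

Lemma vsval_one : vsval (1 : R) = 1.
Proof. by apply/eqP; rewrite algid_eq1. Qed.

Lemma restr_scale1 : left_id 1 restr_scale.
Proof. by move=> x; rewrite /restr_scale vsval_one scale1r. Qed.

Lemma restr_scaleDr : right_distributive restr_scale +%R.
Proof. by move=> a x y; apply: scalerDr. Qed.

Lemma restr_scaleDl x : {morph restr_scale^~ x : a b / a + b}.
Proof. by move=> a b; apply: scalerDl. Qed.

HB.instance Definition _ := GRing.Zmodule_isLmodule.Build
  R (restr M) restr_scaleA restr_scale1 restr_scaleDr restr_scaleDl.

End RestrLmod.

Lemma restrZ (M : lmodType A) (b : R) (x : restr M) : b *: x = vsval b *: (x : M).
Proof. by []. Qed.

(** Tensoring is left adjoint to restriction of scalars, which preserves surjections. *)
Lemma tens_projective X : projective X -> projective (tens X).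
Proof.
move=> prX M N g f gs.
have [a x y|g' g'E] := @linear_of _ _ (restr M) (restr N) g.
  by rewrite [LHS]linearP.
have [a x y|f' f'E] := @linear_of _ _ X (restr N) (fun x => f (pure_tensor 1 x)).
  rewrite pure_addr linearD -pure_bal mul1r -[vsval a]mulr1 -pure_scale linearZ /=.
  by rewrite restrZ.
have [|h' h'E] := prX _ _ g' f'; first by move=> y; have [x <-] := gs y; exists x.
have [|||a a' m|h hE] := @tens_lift_linear X M (fun a m => a *: (h' m : M)).
- by move=> a a' m; rewrite scalerDl.
- by move=> a m m'; rewrite [h' _]linearD [LHS]scalerDr.
- by move=> a r m; rewrite linearZ -scalerA.
- by rewrite scalerA.
exists h; apply: (@tens_lin_eq _ _ (g \o h) f) => m /=.
by rewrite hE scale1r -g'E h'E f'E.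
Qed.

End Restriction.

End Tensor.

(** * Comparison of Ext over [B] and over [A] *)

Section TensorExt.

Variables (K : fieldType) (A : falgType K) (B : {aspace A}).
Local Notation R := (subvs_of B).
Local Notation tmap f := (@tens_map _ _ B _ _ f).

Hypothesis B1 : 1 \in B.
Hypothesis flat_inj : forall (M N : lmodType R) (f : {linear M -> N}),
  injective f -> injective (tmap f).
Hypothesis flat_exact : forall (M N P : lmodType R) (f : {linear M -> N}) (g : {linear N -> P}),
  exact_at f g -> exact_at (tmap f) (tmap g).
Hypothesis flat_surj : forall (M N : lmodType R) (f : {linear M -> N}),
  Defs.surjective f -> Defs.surjective (tmap f).

Variables (M N X0 X1 : lmodType R) (d : {linear X1 -> X0}) (e : {linear X0 -> M}).
Hypotheses (dexact : short_exact d e) (pX0 : projective X0) (pX1 : projective X1).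

(** With [ext1_surj], this is the isomorphism on Ext^1 computed on [X1 -> X0]: there every map from
    [X1] is a cocycle, and the coboundaries are the maps factoring through [d]. *)
Hypothesis ext1_inj : forall f : {linear X1 -> N},
  (exists g : {linear tens X0 -> tens N}, forall x, tmap f x = g (tmap d x)) ->
  exists g : {linear X0 -> N}, forall x, f x = g (d x).
Hypothesis ext1_surj : forall g : {linear tens X1 -> tens N},
  exists (f : {linear X1 -> N}) (h : {linear tens X0 -> tens N}),
    forall x, tmap f x - g x = h (tmap d x).

(** Above degree one both sides vanish. In degree one classes are moved to the short resolution and
    back: [a] and [b] relate it to [P], and [g0], [g1] relate its tensor product to [Q]. *)
Lemma tens_ext_iso_length_one k : tens_ext_iso M N k.
Proof.
case: dexact => di de es.
have tde : short_exact (tmap d) (tmap e).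
  by split; [apply: flat_inj|apply: flat_exact|apply: flat_surj].
have [tdi tde' tes] := tde.
have tpX0 := tens_projective B1 pX0; have tpX1 := tens_projective B1 pX1.
move=> P Q c cE0 cE ext_map.
have exQ0 := exact_comp0 (@res_exact _ _ _ Q 0).
have exP0 := exact_comp0 (@res_exact _ _ _ P 0).
have ext_mapB (f f' : {linear P k.+1 -> N}) x :
    ext_map (f \- f') x = ext_map f x - ext_map f' x.
  exact: (@tens_map_sub _ _ _ _ _ f f' (f \- f')).
case: k @ext_map ext_mapB => [|k] ext_map ext_mapB; last first.
  split=> [f f' fc f'c _|g gc].
    have [|g gE] := @length_one_coboundary _ _ _ _ _ _ _ dexact pX0 pX1 P N k (f \- f').
      by move=> x; rewrite /= fc f'c subrr.
    by exists g => x; rewrite -gE.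
  have [h hE] := @length_one_coboundary _ _ _ _ _ _ _ tde tpX0 tpX1 Q _ k g gc.
  exists \0 => [x|] //.
  exists (\0 \- h) => x; rewrite /= -hE; congr (_ - _).
  by rewrite /ext_map tens_map_eq0.
have [a0 [a1 [a0E a1E]]] := comparison idfun pX0 pX1 (exact_comp0 de)
  (@res_surj _ _ _ P) (@res_exact0 _ _ _ P).
have [b0 [b1 [b0E b1E]]] := comparison idfun (@res_proj _ _ _ P 0)
  (@res_proj _ _ _ P 1) (exact_comp0 (@res_exact0 _ _ _ P)) es de.
have [g0 [g1 [g0E g1E]]] := comparison idfun tpX0 tpX1 (exact_comp0 tde')
  (@res_surj _ _ _ Q) (@res_exact0 _ _ _ Q).
have b1d x : b1 (res_d P 1 x) = 0.
  by apply: (inj_exact0 di); rewrite b1E exP0 linear0.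
split.
  move=> f f' fc f'c [g gE].
  pose F : {linear P 1 -> N} := f \- f'.
  have Fc : cocycle F by move=> x; rewrite /F /= fc f'c subrr.
  have {}gE x : tmap F (c 1%N x) = g (res_d Q 0 x) by rewrite -gE -ext_mapB.
  (* [c] after [g0], [g1] and the tensored [a] both lift the identity, hence are homotopic. So
     [F \o a1] becomes a coboundary after tensoring, and [ext1_inj] applies. *)
  have [||||h [_ hE]] := @homotopy _ _ _ _ _ _ _ _ _ idfun (tmap d) (tmap e)
      (tmap (res_d P 1)) (tmap (res_d P 0)) (tmap (res_aug P))
      (c 0%N \o g0) (tmap a0) (c 1%N \o g1) (tmap a1) tpX0
      (flat_exact (@res_exact0 _ _ _ P)) (flat_exact (@res_exact _ _ _ P 0)).
  - by move=> x /=; rewrite cE0 g0E.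
  - by move=> x /=; rewrite cE g1E.
  - move=> x /=; rewrite -(@tens_map_comp _ _ _ _ _ _ _ _ (res_aug P \o a0)) //.
    by apply: tens_map_ext => y /=; rewrite a0E.
  - move=> x /=; rewrite -(@tens_map_comp _ _ _ _ _ _ _ _ (res_d P 0 \o a1)) //.
    by apply: tens_map_comp => y /=; rewrite a1E.
  have [|f1 f1E] := ext1_inj (f := F \o a1).
    exists ((g \o g0) \- (tmap F \o h)) => x /=.
    have [y yE] := hE x.
    rewrite -g1E -gE (@tens_map_comp _ _ _ _ _ _ F a1) // -[RHS]linearB /=.
    have : tmap F (tmap (res_d P 1) y) = 0.
      rewrite -(@tens_map_comp _ _ _ _ _ _ F _ (F \o res_d P 1)) //.
      by apply: tens_map_eq0 => z; apply: Fc.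
    rewrite -yE !linearB /= => /eqP; rewrite subr_eq0 subr_eq => /eqP ->.
    by rewrite addrC addKr.
  (* The round trip on [P] is homotopic to the identity, so [F] differs by a coboundary from
     [F \o a1 \o b1], itself a coboundary. *)
  have [||||h' [_ h'E]] := @homotopy _ _ _ _ _ _ _ _ _ idfun (res_d P 0) (res_aug P)
      (res_d P 1) (res_d P 0) (res_aug P) idfun (a0 \o b0) idfun (a1 \o b1)
      (@res_proj _ _ _ P 0) (@res_exact0 _ _ _ P) (@res_exact _ _ _ P 0) => //.
  - by move=> x /=; rewrite a0E /= b0E.
  - by move=> x /=; rewrite a1E b1E.
  exists ((F \o h') \+ (f1 \o b0)) => x /=.
  have [y yE] := h'E x; have := Fc y; rewrite -yE 2!linearB => Fx.
  have {Fx} : F x - F (a1 (b1 x)) - F (h' (res_d P 0 x)) = 0 by [].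
  move/eqP; rewrite subr_eq0 subr_eq => /eqP Fx.
  rewrite -[LHS]/(F x) Fx -[RHS]/(F (h' (res_d P 0 x)) + f1 (b0 (res_d P 0 x))).
  by have /= -> := f1E (b1 x); rewrite b1E.
move=> g gc.
(* On [Q] the identity is homotopic to the round trip through [P] and the short resolution, so [g]
   may be replaced by [g \o g1] carried back. *)
have [||||h [_ hE]] := @homotopy _ _ _ _ _ _ _ _ _ idfun (res_d Q 0) (res_aug Q)
    (res_d Q 1) (res_d Q 0) (res_aug Q)
    idfun (g0 \o (tmap b0 \o c 0%N)) idfun (g1 \o (tmap b1 \o c 1%N))
    (@res_proj _ _ _ Q 0) (@res_exact0 _ _ _ Q) (@res_exact _ _ _ Q 0) => //.
- move=> x /=; rewrite g0E /= -cE0.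
  by rewrite -(@tens_map_comp _ _ _ _ _ _ e b0 (res_aug P)) // => y; rewrite b0E.
- move=> x /=; rewrite g1E -cE; congr (g0 _).
  transitivity (tmap (d \o b1) (c 1%N x)); first exact/esym/tens_map_comp.
  by apply: tens_map_comp => y /=; rewrite b1E.
have [f1 [f2 fE]] := ext1_surj (g \o g1).
exists (f1 \o b1) => [x|]; first by rewrite /= b1d linear0.
exists ((f2 \o (tmap b0 \o c 0%N)) \- (g \o h)) => x.
have [y yE] := hE x; have := gc y; rewrite -yE !linearB /= => /eqP.
rewrite !subr_eq add0r => /eqP ->.
rewrite /ext_map (@tens_map_comp _ _ _ _ _ _ f1 b1) //.
have := fE (tmap b1 (c 1%N x)).
rewrite -(@tens_map_comp _ _ _ _ _ _ d b1 (d \o b1)) //.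
rewrite (@tens_map_comp _ _ _ _ _ _ b0 (res_d P 0) (d \o b1)) ?cE => [|z]; last by rewrite /= b1E.
by move=> /= <-; rewrite opprD [X in _ + X]addrC addrA.
Qed.

End TensorExt.

(** * Incidence algebras *)

Section ScalarAction.

Variables (K : fieldType) (A : falgType K).
Implicit Types M N S : lmodType A.

(** An [lmodType A] has no declared action of [K]; scalars act through their images in [A]. *)
Definition ksc M (k : K) (x : M) : M := (k%:A : A) *: x.

Lemma kscA M k k' (x : M) : ksc k (ksc k' x) = ksc (k * k') x.
Proof. by rewrite /ksc scalerA mulr_algl scalerA. Qed.

Lemma kscE M k (a : A) (x : M) : (k *: a) *: x = ksc k (a *: x).
Proof. by rewrite /ksc scalerA mulr_algl. Qed.

Lemma scale_ksc M (a : A) k (x : M) : a *: ksc k x = ksc k (a *: x).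
Proof. by rewrite /ksc !scalerA mulr_algl mulr_algr. Qed.

Lemma ksc1 M (x : M) : ksc 1 x = x.
Proof. by rewrite /ksc !scale1r. Qed.

Lemma ksc0 M (x : M) : ksc 0 x = 0.
Proof. by rewrite /ksc !scale0r. Qed.

Lemma linear_ksc M N (f : {linear M -> N}) k x : f (ksc k x) = ksc k (f x).
Proof. exact: linearZ. Qed.

Lemma ksc_eq0 M k (x : M) : ksc k x = 0 -> k != 0 -> x = 0.
Proof.
by move=> kx k0; rewrite -[x]ksc1 -(mulVf k0) -kscA kx /ksc scaler0.
Qed.

Lemma ker_short_exact M S (g : {linear M -> S}) : Defs.surjective g ->
  exists f : {linear lin_ker g -> M}, short_exact f g.
Proof.
move=> gs; have [a x y|f fE] := @linear_of _ _ (lin_ker g) M (@kerval _ _ _ _ g).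
  by [].
exists f; split=> //; first by move=> x y; rewrite !fE => /val_inj.
move=> y; split=> [gy|[x <-]]; last by rewrite fE; apply/eqP/(valP x).
have yk : y \in in_ker g by apply/eqP.
by exists (LinKer yk); rewrite fE.
Qed.

Lemma short_exact_ker N M S (f : {linear N -> M}) (g : {linear M -> S}) :
  short_exact f g -> lmod_iso N (lin_ker g).
Proof.
move=> [fi fg _]; have fker x : f x \in in_ker g by apply/eqP/(exact_comp0 fg).
have [a x y|h hE] := @linear_of _ _ N (lin_ker g) (fun x => LinKer (fker x)).
  by apply: val_inj; rewrite [LHS]linearP.
apply: (lmod_iso_of (f := h)) => [x|y].
  by rewrite hE => /(congr1 val) fx0; apply: (inj_exact0 fi).
have /eqP/fg[x xy] := valP y.
by exists x; rewrite hE; apply: val_inj.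
Qed.

Lemma filtered_ker (C : lmodType A -> Prop) M S (g : {linear M -> S}) :
  Defs.surjective g -> filtered C (lin_ker g) -> C S -> filtered C M.
Proof.
by move=> gs fK CS; have [f fg] := ker_short_exact gs; apply: FilteredS fg fK CS.
Qed.

Lemma filtered_sub (C C' : lmodType A -> Prop) M :
  (forall S, C S -> C' S) -> filtered C M -> filtered C' M.
Proof.
move=> CC'; elim=> {M} [M M0|M N S f g fg _ IH CS]; first exact: Filtered0.
exact: FilteredS fg IH (CC' _ CS).
Qed.

End ScalarAction.

Section Incidence.

Variables (K : fieldType) (n : nat) (A : falgType K) (R : rel 'I_n.+1).
Variables (phi : {linear A -> 'M[K]_n.+1}) (psi : 'M[K]_n.+1 -> A).
Local Notation I := 'I_n.+1.
Implicit Types (i j k t : I) (a b : A) (M N D P S : lmodType A).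

(* [phi] identifies [A] with the matrices supported on [R]; the path from [i] *)
(* to [j] corresponds to the entry in row [j] and column [i].                 *)
Record incidence_model : Prop := IncidenceModel {
  inc_refl : reflexive R;
  inc_leq : forall i j, R i j -> (i <= j)%N;
  phi_mul : forall a b, phi (a * b) = phi a *m phi b;
  phi_one : phi 1 = 1%:M;
  phiK : cancel phi psi;
  phi_supp : forall a i j, ~~ R i j -> phi a j i = 0;
  psiK : forall m : 'M[K]_n.+1, (forall i j, ~~ R i j -> m j i = 0) -> phi (psi m) = m }.

Hypothesis inc : incidence_model.

Let phi_inj : injective phi := can_inj (phiK inc).

Definition munit j i : A := psi (delta_mx j i).
Local Notation e i := (munit i i).

Lemma phi_munit i j : R i j -> phi (munit j i) = delta_mx j i.
Proof.
move=> ij; apply: (psiK inc) => i' j' nij; rewrite mxE.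
by case: andP => // -[/eqP jj /eqP ii]; move: nij; rewrite jj ii ij.
Qed.

Lemma phi_e i : phi (e i) = delta_mx i i.
Proof. exact/phi_munit/(inc_refl inc). Qed.

Lemma phi_neq0 a i j : phi a j i != 0 -> R i j.
Proof. by apply: contraNT => /(phi_supp inc a) ->. Qed.

Lemma munit_mul i j k : R i j -> R j k -> munit k j * munit j i = munit k i.
Proof.
move=> ij jk; have E : phi (munit k j * munit j i) = delta_mx k i.
  by rewrite (phi_mul inc) !phi_munit // mul_delta_mx.
have ik : R i k.
  by apply: (@phi_neq0 (munit k j * munit j i)); rewrite E mxE !eqxx oner_neq0.
by apply: phi_inj; rewrite E phi_munit.
Qed.

(** Forced by closure under products: the product of two matrix units has a nonzero entry, which
    must lie in the support. *)
Lemma inc_trans i j k : R i j -> R j k -> R i k.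
Proof.
move=> ij jk; apply: (@phi_neq0 (munit k j * munit j i)).
by rewrite (phi_mul inc) !phi_munit // mul_delta_mx mxE !eqxx oner_neq0.
Qed.

Lemma e_idem i : e i * e i = e i.
Proof. exact: munit_mul (inc_refl inc i) (inc_refl inc i). Qed.

Lemma delta_mul_mx (m : 'M[K]_n.+1) i j k : (delta_mx j j *m m) k i = (k == j)%:R * m k i.
Proof.
rewrite mxE (bigD1 j) //= big1 ?addr0 => [|l lj]; rewrite !mxE.
  by rewrite eqxx andbT; case: eqP => [->|] //; rewrite !mul0r.
by rewrite (negPf lj) andbF mul0r.
Qed.

Lemma mul_mx_delta (m : 'M[K]_n.+1) i j k : (m *m delta_mx j j) k i = m k i * (i == j)%:R.
Proof.
rewrite mxE (bigD1 j) //= big1 ?addr0 => [|l lj]; rewrite !mxE.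
  by rewrite eqxx /=; case: eqP => [->|] //; rewrite !mulr0.
by rewrite (negPf lj) mulr0.
Qed.

(** Off the relation the coefficient is zero, so the value of [munit j i] there is harmless. *)
Lemma e_mul_e a i j : e j * a * e i = phi a j i *: munit j i.
Proof.
apply: phi_inj; rewrite linearZ !(phi_mul inc) !phi_e; apply/matrixP=> k l /=.
rewrite mul_mx_delta delta_mul_mx [RHS]mxE.
have [ij|ij] := boolP (R i j).
  rewrite phi_munit // mxE; case: eqP => [->|_]; last by rewrite !mul0r mulr0.
  by case: eqP => [->|_]; rewrite ?mulr0 // mul1r.
rewrite (phi_supp inc a ij) mul0r.
case: eqP => [->|_]; last by rewrite !mul0r.
by case: eqP => [->|_]; rewrite ?mulr0 // (phi_supp inc a ij) mulr0 mul0r.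
Qed.

Lemma sum_e : \sum_i e i = 1.
Proof.
apply: phi_inj; rewrite linear_sum (phi_one inc) /=.
rewrite (mx1_sum_delta) /=; apply: eq_bigr => i _; exact: phi_e.
Qed.

Lemma sum_e_act M (x : M) : x = \sum_i e i *: x.
Proof. by rewrite -scaler_suml sum_e scale1r. Qed.

Lemma e_act_eq0 M (x : M) : (forall i, e i *: x = 0) -> x = 0.
Proof. by move=> x0; rewrite [x]sum_e_act big1. Qed.

Lemma e_act M (a : A) (x : M) j :
  e j *: (a *: x) = \sum_i ksc (phi a j i) (munit j i *: (e i *: x)).
Proof.
rewrite {1}[x]sum_e_act !scaler_sumr; apply: eq_bigr => i _.
rewrite -kscE -e_mul_e -!scalerA; congr (_ *: (_ *: _)).
by rewrite scalerA e_idem.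
Qed.

(* [e i M] is the only possibly nonzero contribution to [e i (a x)] when the  *)
(* vertex [i] is a source of the support of [M].                              *)
Lemma source_act M i : (forall k, (k < i)%N -> forall x : M, e k *: x = 0) ->
  forall a (x : M), e i *: (a *: x) = ksc (phi a i i) (e i *: x).
Proof.
move=> M0 a x; rewrite e_act (bigD1 i) //= big1 ?addr0 => [|k ki].
  by rewrite scalerA e_idem.
have [ki'|ik] := ltnP k i; first by rewrite M0 // scaler0 /ksc scaler0.
rewrite (phi_supp inc) ?ksc0 //; apply/negP => /(inc_leq inc).
move: ki ik; rewrite -val_eqE /=; lia.
Qed.

(** Elements of [A] never lower the vertex, so at a sink of the support [e i M] is a submodule, with
    the action of the simple module at [i]. *)
Lemma sink_act M i : (forall k, (i < k)%N -> forall x : M, e k *: x = 0) ->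
  forall a (x : M), a *: (e i *: x) = ksc (phi a i i) (e i *: x).
Proof.
move=> M0 a x; rewrite [LHS]sum_e_act (bigD1 i) //= big1 ?addr0 => [|k ki].
  by rewrite !scalerA e_mul_e kscE.
have [/M0 -> //|ki'] := ltnP i k.
rewrite !scalerA e_mul_e kscE (phi_supp inc) ?ksc0 //; apply/negP => /(inc_leq inc).
move: ki ki'; rewrite -val_eqE /=; lia.
Qed.

Lemma idval_supp i (x : idmod (e i)) j k : k != i -> phi (idval x) j k = 0.
Proof.
move=> ki; rewrite -idvalP (phi_mul inc) phi_e mul_mx_delta (negPf ki).
by rewrite mulr0.
Qed.

Lemma idmod_eq i (x y : idmod (e i)) :
  (forall j, phi (idval x) j i = phi (idval y) j i) -> x = y.
Proof.
move=> xy; apply/idval_inj/phi_inj/matrixP=> j k.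
by have [->|ki] := eqVneq k i; rewrite ?xy // !idval_supp.
Qed.

Lemma munit_idmod i t : R i t -> {x : idmod (e i) | idval x = munit t i}.
Proof. by move=> it; apply/idmod_of/munit_mul => //; apply: (inc_refl inc). Qed.

(** This is the condition that every [e j M] has dimension at most one. *)
Definition thin M := forall j (x y : M), e j *: x != 0 ->
  exists c, e j *: y = ksc c (e j *: x).

Lemma thin_ker M N (f : {linear M -> N}) : thin M -> thin (lin_ker f).
Proof.
move=> tM j x y jx; have [|c cE] := tM j (val x) (val y).
  by apply: contraNneq jx => jx0; apply/eqP/val_inj.
by exists c; apply: val_inj.
Qed.

Lemma thin_quotient M N (f : {linear M -> N}) : Defs.surjective f -> thin M -> thin N.
Proof.
move=> fs tM j x y; have [x' <-] := fs x; have [y' <-] := fs y => jx.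
have [|c cE] := tM j x' y'.
  by apply: contraNneq jx => jx0; rewrite -linearZ /= jx0 linear0.
by exists c; rewrite -!linearZ /= cE linear_ksc.
Qed.

Lemma thin_idmod i : thin (idmod (e i)).
Proof.
have E j (x : idmod (e i)) : idval (e j *: x) = phi (idval x) j i *: munit j i.
  by rewrite idvalZ -idvalP mulrA e_mul_e idvalP.
move=> j x y jx; have x0 : phi (idval x) j i != 0.
  apply: contraNneq jx => x0; apply/eqP/idval_inj.
  by rewrite E x0 scale0r.
exists (phi (idval y) j i / phi (idval x) j i); apply: idval_inj.
by rewrite E /ksc idvalZ E mulr_algl scalerA divfK.
Qed.

(** The simple module at [i], seen through a coordinate in [K]; it covers [vertex_simple] and its
    restriction to [B]. *)
Record vertex_mod i M (l : M -> K) : Prop := VertexMod {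
  vm_add : {morph l : x y / x + y};
  vm_inj : injective l;
  vm_surj : exists v, l v = 1;
  vm_act : forall a x, l (a *: x) = phi a i i * l x }.

Section VertexMod.

Variables (i : I) (M : lmodType A) (l : M -> K).
Hypothesis vm : vertex_mod i l.

Lemma vm_ksc (c : K) x : l (ksc c x) = c * l x.
Proof.
by rewrite (vm_act vm) linearZ (phi_one inc) /= !mxE eqxx mulr1.
Qed.

Lemma vm_gen v : l v = 1 -> forall x, x = ksc (l x) v.
Proof. by move=> lv x; apply: (vm_inj vm); rewrite vm_ksc lv mulr1. Qed.

Lemma vm0 : l 0 = 0.
Proof. by rewrite -(scale0r 0) (vm_act vm) linear0 mxE mul0r. Qed.

Lemma vm_eq0 x : l x = 0 -> x = 0.
Proof. by move=> lx; apply: (vm_inj vm); rewrite vm0. Qed.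

Lemma vm_simple : simple_mod M.
Proof.
have [v lv] := vm_surj vm; split.
  by exists v; apply: contra_eq_neq lv => ->; rewrite vm0 eq_sym oner_neq0.
move=> N; have [[x [xN x0]]|nex] := pselect (exists x, x \in N /\ x <> 0); last first.
  by left=> x xN; apply: contrapT => x0; apply: nex; exists x.
right=> y; have lx : l x != 0 by apply/eqP => /vm_eq0.
have -> : y = ksc (l y / l x) x.
  by apply: (vm_inj vm); rewrite vm_ksc divfK.
exact: rpredZ.
Qed.

Lemma vm_e j (x : M) : e j *: x = if j == i then x else 0.
Proof.
apply: (vm_inj vm); rewrite (vm_act vm) phi_e mxE eq_sym.
by case: ifP => _; rewrite /= ?mul1r // mul0r vm0.
Qed.

End VertexMod.

Section Filtration.

Variables (L : I -> lmodType A) (l : forall i, L i -> K).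
Hypothesis vmL : forall i, vertex_mod i (@l i).

Lemma vm_hom i N (w : N) : (forall a, a *: w = ksc (phi a i i) w) ->
  exists f : {linear L i -> N}, forall x, f x = ksc (l x) w.
Proof.
move=> aw; have [a x y|f fE] := @linear_of _ _ (L i) N (fun x => ksc (l x) w).
  rewrite (vm_add (vmL i)) (vm_act (vmL i)) scale_ksc aw kscA mulrC.
  by rewrite /ksc -scalerDl -scalerDl.
by exists f.
Qed.

Lemma hom_vm i N (g : N -> K) : {morph g : x y / x + y} ->
  (forall a x, g (a *: x) = phi a i i * g x) ->
  exists f : {linear N -> L i}, forall x, l (f x) = g x.
Proof.
move=> gD gZ; have [v lv] := vm_surj (vmL i).
have lE x : l (ksc (g x) v) = g x by rewrite (vm_ksc (vmL i)) lv mulr1.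
have [a x y|f fE] := @linear_of _ _ N (L i) (fun x => ksc (g x) v).
  by apply: (vm_inj (vmL i)); rewrite lE (vm_add (vmL i)) (vm_act (vmL i)) !lE gD gZ.
by exists f => x; rewrite fE lE.
Qed.

(** In a simple module [S], take the largest [i] with [e i S] nonzero: a nonzero [e i *: y] spans a
    copy of [L i], which must be everything. *)
Lemma incidence_simples : complete_simples L.
Proof.
split=> [i|i j [f [g fK gK]]|S [[x x0] sS]]; first exact: (vm_simple (vmL i)).
  have [v lv] := vm_surj (vmL i); apply/eqP; apply: contraTT isT => ij.
  have : f (e i *: v) = 0 by rewrite linearZ /= (vm_e (vmL j)) (negPf ij).
  rewrite (vm_e (vmL i)) eqxx -(linear0 f) => /(can_inj fK) v0.
  by move: lv; rewrite v0 (vm0 (vmL i)) => /eqP; rewrite eq_sym oner_eq0.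
have [i0 i0x] : exists i, `[< exists x : S, e i *: x <> 0 >].
  apply: contrapT => ne; move/eqP: x0; apply; apply: e_act_eq0 => i.
  by apply: contrapT => ix; apply: ne; exists i; apply/asboolP; exists x.
pose Q := fun i => `[< exists x : S, e i *: x <> 0 >].
case: (@arg_maxnP _ i0 Q (fun i => val i) i0x) => i /asboolP[y y0] imax.
have S0 k : (i < k)%N -> forall x : S, e k *: x = 0.
  move=> ik z; apply: contrapT => kz; have := imax k.
  rewrite /= leqNgt ik => imax'; suff : false by [].
  by apply: imax'; apply/asboolP; exists z.
have [f fE] := @vm_hom i S (e i *: y) ((sink_act S0)^~ y).
exists i; apply: lmod_iso_sym; apply: (lmod_iso_of (f := f)) => [z|z].
  rewrite fE => fz; apply: (vm_eq0 (vmL i)); apply: contrapT => lz.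
  by apply: y0; apply: ksc_eq0 fz _; apply/eqP.
have [v lv] := vm_surj (vmL i).
have [N0|N1] := sS (in_image f); last exact/in_imageP.
case: y0; rewrite -[LHS]ksc1 -lv -fE; apply: N0.
by apply/in_imageP; exists v.
Qed.

(** The least vertex [i] of the support is a source, so the coordinate at [i] maps [M] onto [L i],
    and the kernel is thin with [i] removed from its support. *)
Lemma filtered_thin (C : lmodType A -> Prop) (J : {set I}) M : thin M ->
  (forall j, j \notin J -> forall x : M, e j *: x = 0) ->
  (forall j, j \in J -> C (L j)) -> filtered C M.
Proof.
have [m] := ubnP #|J|; elim: m J M => // m IHm J M; rewrite ltnS => Jm tM M0 CJ.
have [J0|[j0 j0J]] := set_0Vmem J.
  by apply: Filtered0 => x; apply: e_act_eq0 => i; apply: M0; rewrite J0 in_set0.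
case: (@arg_minnP _ j0 (mem J) (fun i => val i) j0J) => i iJ imin.
have {}iJ : i \in J := iJ.
have card : (#|J :\ i| < m)%N by move: Jm; rewrite (cardsD1 i) iJ.
have CJ' j : j \in J :\ i -> C (L j) by move=> /setD1P[_]; apply: CJ.
have nJ' j : j \notin J :\ i -> j = i \/ j \notin J.
  by rewrite !inE negb_and negbK => /orP[/eqP->|]; [left|right].
have [[x0 x0i]|nx] := pselect (exists x : M, e i *: x <> 0); last first.
  apply: (IHm (J :\ i)) => // j /nJ'[->|/M0 //] x.
  by apply: contrapT => xi; apply: nx; exists x.
have Mlt k : (k < i)%N -> forall x : M, e k *: x = 0.
  move=> ki; apply: M0; apply/negP => /imin.
  by rewrite leqNgt ki.
have x0i' : e i *: x0 != 0 by apply/eqP.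
have /choice[c cE] : forall y : M, exists c, e i *: y = ksc c (e i *: x0).
  by move=> y; apply: tM.
have cinj (s s' : K) : ksc s (e i *: x0) = ksc s' (e i *: x0) -> s = s'.
  move=> ss'; apply: contrapT => /eqP; rewrite -subr_eq0 => nss'; apply: x0i.
  apply: ksc_eq0 nss'; rewrite /ksc scalerBl scalerBl -[X in X - _]/(ksc s (e i *: x0)) ss'.
  exact: subrr.
have cD : {morph c : x y / x + y}.
  by move=> x y; apply: cinj; rewrite -cE scalerDr (cE x) (cE y) /ksc -!scalerDl.
have cZ a x : c (a *: x) = phi a i i * c x.
  by apply: cinj; rewrite -cE (source_act Mlt) (cE x) kscA.
have [f fE] := hom_vm cD cZ.
have c0 : c x0 = 1 by apply: cinj; rewrite -cE ksc1.
apply: (@filtered_ker _ _ _ _ _ f) (CJ i iJ).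
  move=> y; exists (ksc (l y) x0); apply: (vm_inj (vmL i)).
  by rewrite fE /ksc cZ linearZ (phi_one inc) /= !mxE eqxx c0 !mulr1.
apply: (IHm (J :\ i)) => // [|j nj x]; first exact: thin_ker.
apply: val_inj; case: (nJ' j nj) => [->|jJ]; last exact: M0.
have /eqP fx := valP x; rewrite [LHS]cE.
by rewrite -fE [f _]fx (vm0 (vmL i)) ksc0.
Qed.

Lemma top_map i : exists p : {linear idmod (e i) -> L i},
  forall x, l (p x) = phi (idval x) i i.
Proof.
have [v lv] := vm_surj (vmL i); have [p pE] := idmod_map (e i) v.
by exists p => x; rewrite pE (vm_act (vmL i)) lv mulr1.
Qed.

Section TopMap.

Variables (i : I) (p : {linear idmod (e i) -> L i}).
Hypothesis pE : forall x, l (p x) = phi (idval x) i i.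

Lemma top_map_surj : Defs.surjective p.
Proof.
move=> y; have [x xe] := munit_idmod (inc_refl inc i).
exists (ksc (l y) x); apply: (vm_inj (vmL i)).
by rewrite linear_ksc (vm_ksc (vmL i)) pE xe phi_e mxE eqxx mulr1.
Qed.

(** If [N] meets every class modulo the kernel of [p], it contains some [y] with coefficient 1 at
    [i], and [e i *: y] is then the generator. *)
Lemma top_map_cover : projective_cover p.
Proof.
split; [exact/idmod_findim/e_idem|exact/idmod_projective/e_idem|exact: top_map_surj|].
move=> N Np; have [x xe] := munit_idmod (inc_refl inc i).
have [y yN] := Np x; rewrite linearB => /eqP; rewrite subr_eq0 => /eqP xy.
have xN : x \in N.
  suff -> : x = e i *: y by apply: rpredZ.
  apply: idval_inj; rewrite idvalZ -[idval y]idvalP mulrA e_mul_e xe.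
  by rewrite -pE -xy pE xe phi_e mxE eqxx scale1r.
move=> z; suff -> : z = idval z *: x by apply: rpredZ.
by apply: idval_inj; rewrite idvalZ xe idvalP.
Qed.

End TopMap.

(** * Standard modules and quasi-heredity of incidence algebras *)

Section Standard.

Variables (le : rel I) (D : I -> lmodType A) (q : forall i, {linear idmod (e i) -> D i}).
Hypotheses (le_refl : reflexive le) (le_anti : antisymmetric le) (le_trans : transitive le).
Hypothesis q_surj : forall i, Defs.surjective (q i).
Hypothesis q_ker : forall i x, q i x = 0 <-> forall j, le j i -> phi (idval x) j i = 0.
(** The successors of [i] outside the support of its standard module are either none or exactly
    those of one vertex [t]; so the kernel of [q i] is zero or a copy of [A e_t]. *)
Hypothesis next : forall i, (forall j, R i j -> le j i) \/
  exists t, [/\ R i t, le i t, i != t & forall j, R i j -> le j i = ~~ R t j].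

Lemma factors_le_supp i M : factors_le le L i M ->
  forall j, ~~ le j i -> forall x : M, e j *: x = 0.
Proof.
move=> fM j ji; elim: fM => {M} [M M0 x|M N S f g [fi fg gs] _ IH [k ki [h [h' hK _]]] x].
  by rewrite [LHS]M0.
have S0 (y : S) : e j *: y = 0.
  apply: (can_inj hK); rewrite linearZ /= (vm_e (vmL k)) linear0.
  by case: eqP => // jk; rewrite jk ki in ji.
have [|y yE] := (fg (e j *: x)).1; first by rewrite linearZ /= S0.
by rewrite -(e_idem j) -scalerA -yE -linearZ /= IH linear0.
Qed.

Lemma std_e i j x : ~~ le j i -> e j *: (x : D i) = 0.
Proof.
move=> ji; have [y <-] := q_surj x; rewrite -linearZ; apply/q_ker => k ki.
rewrite idvalZ (phi_mul inc) phi_e delta_mul_mx; case: eqP => [kj|]; last by rewrite mul0r.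
by rewrite -kj ki in ji.
Qed.

Lemma std_thin i : thin (D i).
Proof. exact: thin_quotient (@q_surj i) (@thin_idmod i). Qed.

Lemma std_factors i : factors_le le L i (D i).
Proof.
apply: (filtered_thin (J := [set j | le j i])); first exact: std_thin.
  by move=> j; rewrite inE => ji x; apply: std_e.
by move=> j; rewrite inE => ji; exists j => //; apply: lmod_iso_refl.
Qed.

Lemma std_largest i : largest_quotient le L i (q i).
Proof.
split; [exact: q_surj|exact: std_factors|move=> D' q' q's fD'].
apply: factor_through; first exact: q_surj.
move=> x /q_ker qx; rewrite [q' x]sum_e_act big1 // => j _.
have [ji|/(factors_le_supp fD') -> //] := boolP (le j i).
rewrite -linearZ /= (_ : e j *: x = 0) ?linear0 //; apply: idval_inj.
by rewrite idvalZ -idvalP mulrA e_mul_e qx // scale0r.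
Qed.

Lemma std_standard i : is_standard le L i (D i).
Proof.
have [p pE] := top_map i.
by exists (idmod (e i)), p, (q i); split; [apply: top_map_cover|apply: std_largest].
Qed.

Lemma std_next i : injective (q i) \/
  exists t (d : {linear idmod (e t) -> idmod (e i)}),
    [/\ [/\ R i t, le i t, i != t & forall j, R i j -> le j i = ~~ R t j],
        short_exact d (q i) & forall x, idval (d x) = idval x * munit t i].
Proof.
case: (next i) => [R_le|[t [it lit nit tE]]]; [left|right].
  move=> x y /eqP; rewrite -subr_eq0 -linearB => /eqP/q_ker qxy.
  apply/eqP; rewrite -subr_eq0; apply/eqP/idmod_eq => j; rewrite [X in _ = X](_ : _ = 0); last first.
    by rewrite -[idval 0]/(0 : A) linear0 mxE.
  have [/R_le/qxy //|nij] := boolP (R i j); exact: (phi_supp inc).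
have [w wE] := munit_idmod it; have [d dE] := idmod_map (e t) w.
have phid (x : idmod (e t)) j : phi (idval (d x)) j i = phi (idval x) j t.
  rewrite dE idvalZ wE (phi_mul inc) phi_munit // mxE (bigD1 t) //= big1 ?addr0.
    by rewrite mxE !eqxx mulr1.
  by move=> k kt; rewrite mxE (negPf kt) mulr0.
exists t, d; split=> // [|x]; last by rewrite dE idvalZ wE.
split; last exact: q_surj.
  by move=> x y dxy; apply: idmod_eq => j; rewrite -!phid dxy.
move=> y; split=> [/q_ker qy|[x <-]]; last first.
  apply/q_ker => j ji; rewrite phid; apply: (phi_supp inc).
  have [tj|//] := boolP (R t j).
  by move: ji; rewrite tE ?tj //; apply: inc_trans tj.
(* Right multiplication by the path from [i] to [t] moves column [t] to column [i]; the preimage of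
   [y] has the column [i] of [y] placed in column [t]. *)
pose m0 := \matrix_(j, k) (phi (idval y) j i *+ (k == t)).
have m0E : phi (psi m0) = m0.
  apply: (psiK inc) => k j kj; rewrite mxE; case: eqP => [kt|//].
  rewrite kt in kj; rewrite mulr1n; apply: contrapT => /eqP yj.
  have ij := phi_neq0 yj.
  by move/eqP: yj; apply; apply: qy; rewrite tE.
have [|x xE] := @idmod_of _ _ (e t) (psi m0).
  apply: phi_inj; rewrite (phi_mul inc) m0E phi_e; apply/matrixP => j k.
  by rewrite mul_mx_delta !mxE; case: eqP; rewrite ?mulr1 // mulr0.
by exists x; apply: idmod_eq => j; rewrite phid xE m0E mxE eqxx.
Qed.

(** If nonzero, the kernel of [q i] is [A e_t], with quotient [D t] and submodule the kernel of
    [q t]; the induction applies because [t] is beyond [i]. *)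
Lemma std_filtered i :
  filtered (fun S => exists j, [/\ le i j, i != j & is_standard le L j S]) (lin_ker (q i)).
Proof.
have [m] := ubnP (n - i)%N; elim: m i => // m IHm i im.
case: (std_next i) => [qi|[t [d [[it lit nit _] dq _]]]].
  apply: Filtered0 => x; apply: val_inj; apply: (inj_exact0 qi).
  exact/eqP/(valP x).
have it' : (i < t)%N by rewrite ltn_neqAle (inc_leq inc it) andbT.
apply: (filtered_iso (short_exact_ker dq)).
apply: (@filtered_ker _ _ _ _ _ (q t)); first exact: q_surj.
  have tm : (n - t < m)%N by have := ltn_ord t; move: im it' => /=; lia.
  apply: filtered_sub (IHm t tm) => S [j [tj ntj Sj]]; exists j; split=> //.
    exact: le_trans tj.
  by apply: contraNneq ntj => ij; apply/eqP/le_anti; rewrite tj -ij lit.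
by exists t; split=> //; apply: std_standard.
Qed.

Lemma incidence_quasi_hereditary : quasi_hereditary le L.
Proof.
split=> //; first exact: incidence_simples.
move=> i; have [p pE] := top_map i.
have [|r rE] := factor_through (@q_surj i) (f := p).
  by move=> x /q_ker qx; apply: (vm_eq0 (vmL i)); rewrite pE qx.
exists (idmod (e i)), (D i), p, (q i), r; split=> //.
- exact: top_map_cover.
- exact: std_largest.
- exact: std_filtered.
apply: (filtered_thin (J := [set j | le j i && (j != i)])).
- by apply: thin_ker; apply: std_thin.
- move=> j; rewrite inE negb_and negbK => jJ x; apply: val_inj.
  change (e j *: val x = 0); case/orP: jJ => [ji|/eqP->]; first exact: std_e.
  have /eqP := valP x; have [y <-] := @q_surj i (val x); rewrite rE => py.
  rewrite -linearZ; apply/q_ker => k ki.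
  rewrite idvalZ (phi_mul inc) phi_e delta_mul_mx; case: eqP => [->|]; last by rewrite mul0r.
  by rewrite -pE py (vm0 (vmL i)) mulr0.
- move=> j; rewrite inE => /andP[ji nji]; exists j; split=> //; exact: lmod_iso_refl.
Qed.

Lemma standard_simple i D' : simple_mod (D i) -> is_standard le L i D' -> simple_mod D'.
Proof.
move=> [Dn sD] [P [p' [q' [[_ prP p's p'c] [q's fD' q'u]]]]].
have [p pE] := top_map i; have [_ prI ps pc] := top_map_cover pE.
have [h hE] := prI _ _ p' p p's; have [h' h'E] := prP _ _ p p' ps.
have [_ fD qu] := std_largest i.
have [|g gE] := qu D' (q' \o h) _ fD'.
  move=> y; have [x <-] := q's y.
  have : x \in in_image h.
    apply: p'c => {}x; have [z zx] := ps (p' x).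
    exists (h z); first by apply/in_imageP; exists z.
    by rewrite linearB hE zx subrr.
  by case/in_imageP => z <-; exists z.
have gs : Defs.surjective g.
  move=> y; have [x <-] := q's y.
  have : x \in in_image h.
    apply: p'c => {}x; have [z zx] := ps (p' x).
    exists (h z); first by apply/in_imageP; exists z.
    by rewrite linearB hE zx subrr.
  by case/in_imageP => z <-; exists (q i z); rewrite gE.
have h's : Defs.surjective (q i \o h').
  move=> y; have [x <-] := @q_surj i y.
  have : x \in in_image h'.
    apply: pc => {}x; have [z zx] := p's (p x).
    exists (h' z); first by apply/in_imageP; exists z.
    by rewrite linearB h'E zx subrr.
  by case/in_imageP => z <-; exists z.
have [g' g'E] := q'u _ _ h's fD.
have [K0|K1] := sD (in_ker g).
  apply: simple_mod_iso (conj Dn sD); apply: lmod_iso_of gs => x gx.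
  by apply: K0; apply/eqP.
(* If [g] were zero, [D'] would vanish, and so would [D i], onto which it maps. *)
have D'0 (y : D') : y = 0 by have [x <-] := gs y; apply/eqP/(K1 x).
case: Dn => y /eqP[]; have [x <-] := h's y.
by rewrite -g'E (D'0 (q' x)) linear0.
Qed.

End Standard.

End Filtration.
End Incidence.

(** * The order of a binary search tree *)

Section TreeOrder.

Lemma mem_labels k t i : (i \in labels (inorder k t)) = (k <= i < k + nvertices t)%N.
Proof.
elim: t k => [|l IHl r IHr] k /=; first by rewrite in_nil; lia.
by rewrite mem_cat in_cons IHl IHr; lia.
Qed.

Lemma mem_subtree k t i j : in_subtree_of (inorder k t) i j ->
  (k <= i < k + nvertices t)%N && (k <= j < k + nvertices t)%N.
Proof.
elim: t k => [|l IHl r IHr] k //= /or3P[/andP[/eqP-> ]|/IHl|/IHr]; last 2 first.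
- lia.
- lia.
by rewrite mem_cat !mem_labels; lia.
Qed.

Lemma subtree_node k l r i j :
  in_subtree_of (inorder k (Node l r)) i j =
    [|| (j == k + nvertices l) && (i != j) && (k <= i < k + nvertices (Node l r)),
        in_subtree_of (inorder k l) i j |
        in_subtree_of (inorder (k + nvertices l).+1 r) i j]%N.
Proof.
rewrite /= mem_cat !mem_labels; congr (_ || _).
by apply/idP/idP; lia.
Qed.

Lemma subtree_trans k t i j m : in_subtree_of (inorder k t) i j ->
  in_subtree_of (inorder k t) j m -> in_subtree_of (inorder k t) i m.
Proof.
elim: t k => [|l IHl r IHr] k //; rewrite !subtree_node.
case/or3P=> [ij|ijl|ijr]; case/or3P=> [jm|jml|jmr];
  try have Hl := mem_subtree ijl; try have Hr := mem_subtree ijr;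
  try have Hl' := mem_subtree jml; try have Hr' := mem_subtree jmr;
  try (by exfalso; lia).
all: apply/or3P.
- by apply: Or31; move: jm => /=; lia.
- by apply: Or32; apply: IHl ijl jml.
- by apply: Or31; move: jm => /=; lia.
- by apply: Or33; apply: IHr ijr jmr.
Qed.

Lemma subtree_asym k t i j : in_subtree_of (inorder k t) i j ->
  ~~ in_subtree_of (inorder k t) j i.
Proof.
elim: t k => [|l IHl r IHr] k //; rewrite !subtree_node => ij; apply/negP => ji.
case/or3P: ij => [ij|ijl|ijr]; case/or3P: ji => [ji|jil|jir];
  try have Hl := mem_subtree ijl; try have Hr := mem_subtree ijr;
  try have Hl' := mem_subtree jil; try have Hr' := mem_subtree jir;
  try (by exfalso; lia).
- by have := IHl _ ijl; rewrite jil.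
- by have := IHr _ ijr; rewrite jir.
Qed.

(** A vertex together with its subtrees carries an interval of in-order labels. *)
Lemma subtree_convexl k t i j m : (i < j)%N -> (j < m)%N ->
  in_subtree_of (inorder k t) m i -> in_subtree_of (inorder k t) j i.
Proof.
move=> ij jm; elim: t k => [|l IHl r IHr] k //; rewrite !subtree_node.
case/or3P => [mi|/IHl->|/IHr->]; rewrite ?orbT //.
by apply/or3P/Or31; move: mi; lia.
Qed.

Lemma subtree_convexr k t i j m : (i < j)%N -> (j < m)%N ->
  in_subtree_of (inorder k t) i m -> in_subtree_of (inorder k t) j m.
Proof.
move=> ij jm; elim: t k => [|l IHl r IHr] k //; rewrite !subtree_node.
case/or3P => [mi|/IHl->|/IHr->]; rewrite ?orbT //.
by apply/or3P/Or31; move: mi => /=; lia.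
Qed.

(** Either the label of the root lies between [i] and [j], or both lie in the same subtree. *)
Lemma subtree_lca k t i j : (k <= i)%N -> (i < j)%N -> (j < k + nvertices t)%N ->
  exists m, [/\ (i <= m <= j)%N, (i == m) || in_subtree_of (inorder k t) i m &
    (j == m) || in_subtree_of (inorder k t) j m].
Proof.
elim: t k => [|l IHl r IHr] k ki ij /=; first lia.
move=> jk; rewrite -/(inorder k (Node l r)).
have [jr|rj] := ltnP j (k + nvertices l).
  have [m [imj im jm]] := IHl k ki ij jr; exists m; split=> //.
    by case/orP: im => [->//|ii]; rewrite ii !orbT.
  by case/orP: jm => [->//|jj]; rewrite jj !orbT.
have [ri|ir] := ltnP (k + nvertices l) i.
  have [|m [imj im jm]] := IHr _ ri ij; first lia.
  exists m; split=> //.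
    by case/orP: im => [->//|ii]; rewrite ii !orbT.
  by case/orP: jm => [->//|jj]; rewrite jj !orbT.
exists (k + nvertices l)%N; rewrite eqxx !mem_cat !mem_labels /=; split; first lia.
  by apply/orP; case: ltngtP ir => // ir _; [right; lia|left].
by apply/orP; case: ltngtP rj => // rj _; [right; lia|left].
Qed.

Variables (N : nat) (T : bintree).
Local Notation le := (@tree_le N T).

Lemma tree_le_refl : reflexive le.
Proof. by move=> i; rewrite /tree_le eqxx. Qed.

Lemma tree_le_anti : antisymmetric le.
Proof.
move=> i j /andP[/orP[/eqP//|ij] /orP[/eqP//|ji]].
by have := subtree_asym ij; rewrite ji.
Qed.

Lemma tree_le_trans : transitive le.
Proof.
move=> j i m /orP[/eqP->//|ij] /orP[/eqP<-|jm]; rewrite /tree_le ?ij ?orbT //.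
by rewrite (subtree_trans ij jm) orbT.
Qed.

Lemma tree_le_convexl (i j m : 'I_N) : (i <= j)%N -> (j <= m)%N -> le m i -> le j i.
Proof.
rewrite leq_eqVlt => /orP[/eqP/val_inj->|ij]; first by rewrite tree_le_refl.
rewrite leq_eqVlt => /orP[/eqP/val_inj->//|jm] /orP[/eqP mi|mi].
  by move: jm; rewrite mi; lia.
by rewrite /tree_le (subtree_convexl ij jm mi) orbT.
Qed.

Lemma tree_le_convexr (i j m : 'I_N) : (i <= j)%N -> (j <= m)%N -> le i m -> le j m.
Proof.
rewrite leq_eqVlt => /orP[/eqP/val_inj->//|ij].
rewrite leq_eqVlt => /orP[/eqP/val_inj->|jm]; first by rewrite tree_le_refl.
case/orP => [/eqP mi|mi]; first by move: ij; rewrite mi; lia.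
by rewrite /tree_le (subtree_convexr ij jm mi) orbT.
Qed.

Hypothesis hT : nvertices T = N.

Lemma tree_le_lca (i j : 'I_N) : (i <= j)%N ->
  exists m : 'I_N, [/\ (i <= m)%N, (m <= j)%N, le i m & le j m].
Proof.
rewrite leq_eqVlt => /orP[/eqP/val_inj->|ij].
  by exists j; rewrite tree_le_refl leqnn.
have [|m [/andP[im mj] im' jm']] := @subtree_lca 0 T i j (leq0n _) ij.
  by rewrite hT add0n.
have mN : (m < N)%N by apply: leq_ltn_trans mj (ltn_ord j).
by exists (Ordinal mN).
Qed.

End TreeOrder.

(** * The path algebra as an incidence algebra *)

Section PathMatrix.

Variables (K : fieldType) (n : nat).
Local Notation I := 'I_n.+1.
Local Notation Q := (qpath n).

Lemma last_iota (x : nat) s : last x (iota x.+1 s) = (x + s)%N.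
Proof. by elim: s x => [|s IHs] x /=; rewrite ?addn0 // IHs addSnnS. Qed.

Lemma ptgt_val (p : Q) : val (ptgt p) = (psrc p + size (qpval p).2)%N.
Proof.
case: p => -[x s] sP; rewrite /ptgt /psrc /= -last_iota -(arrow_path_nth sP).
by rewrite last_map.
Qed.

(** Each arrow raises the vertex by one, so the endpoints determine the length and all vertices
    visited. *)
Lemma qpath_inj (p q : Q) : psrc p = psrc q -> ptgt p = ptgt q -> p = q.
Proof.
move=> src /(congr1 val); rewrite !ptgt_val src => /addnI sz.
case: p q src sz => -[x s] sP [[y t] tP]; rewrite /psrc /= => xy sz; subst y.
apply: val_inj => /=; congr (_, _); apply: (inj_map val_inj).
by rewrite (arrow_path_nth sP) (arrow_path_nth tP) sz.
Qed.

Lemma psrc_leq_ptgt (p : Q) : (psrc p <= ptgt p)%N.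
Proof. by have /= -> := ptgt_val p; apply: leq_addr. Qed.

Lemma qpath_between (i j : I) : (i <= j)%N -> exists p : Q, psrc p = i /\ ptgt p = j.
Proof.
move=> ij; suff [s sP sj] : exists2 s, path (@arrow n) i s & last i s = j.
  by exists (@QPath n (i, s) sP).
have [d] : exists d, j = (i + d)%N :> nat by exists (j - i)%N; rewrite subnKC.
elim: d i {ij} => [|d IHd] i jE.
  by exists [::] => //; apply: val_inj; rewrite /= jE addn0.
have kn : (i.+1 < n.+1)%N by have := ltn_ord j; move: jE; lia.
have [|s sP sj] := IHd (Ordinal kn); first by rewrite /= jE addnS addSn.
by exists (Ordinal kn :: s); rewrite //= sP andbT /arrow.
Qed.

Section PathSums.

Variable F : Q -> K.

Lemma sum_paths p :
  \sum_(p' : Q | (psrc p' == psrc p) && (ptgt p' == ptgt p)) F p' = F p.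
Proof.
apply: big_pred1 => p'; apply/andP/eqP => [[/eqP src /eqP tgt]|->//].
exact: qpath_inj.
Qed.

Lemma sum_paths0 (i j : I) : ~~ (i <= j)%N ->
  \sum_(p : Q | (psrc p == i) && (ptgt p == j)) F p = 0.
Proof.
move=> ij; apply: big_pred0 => p; apply: contraNF ij => /andP[/eqP<- /eqP<-].
exact: psrc_leq_ptgt.
Qed.

End PathSums.

(** Each sum has at most one term; summing avoids choosing the path when there is none. *)
Definition path_mx (f : pathalg K n) : 'M[K]_n.+1 :=
  \matrix_(j, i) \sum_(p : Q | (psrc p == i) && (ptgt p == j)) f p.

Definition mx_path (m : 'M[K]_n.+1) : pathalg K n := [ffun p => m (ptgt p) (psrc p)].

Lemma path_mx_linear : linear path_mx.
Proof.
move=> c f g; apply/matrixP => j i; rewrite !mxE mulr_sumr -big_split /=.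
by apply: eq_bigr => p _; rewrite !ffunE.
Qed.

HB.instance Definition _ :=
  GRing.isLinear.Build K (pathalg K n) 'M[K]_n.+1 *:%R path_mx path_mx_linear.

Lemma sum_pcomp (q r : Q) (i j : I) :
  \sum_(p : Q | (psrc p == i) && (ptgt p == j)) (Defs.pcomp q r == Some p)%:R
    = (psrc r == i)%:R * (ptgt q == j)%:R * (ptgt r == psrc q)%:R :> K.
Proof.
have [rq|rq] := eqVneq (ptgt r) (psrc q); last first.
  by rewrite pcompN // mulr0 big1.
have [pq -> Epq] := pcompE rq.
have src : psrc pq = psrc r by rewrite [LHS]/psrc Epq.
have tgt : ptgt pq = ptgt q.
  by rewrite /ptgt Epq /= last_cat; move: rq; rewrite /ptgt /psrc => ->.
rewrite mulr1 big_mkcond (bigD1 pq) //= src tgt eqxx big1 => [|p pqp].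
  by rewrite addr0 -natrM mulnb; case: ifP.
by rewrite (inj_eq (@Some_inj _)) [pq == p]eq_sym (negPf pqp); case: ifP.
Qed.

Lemma path_mx_mul (f g : pathalg K n) : path_mx (f * g) = path_mx f *m path_mx g.
Proof.
apply/matrixP => j i; rewrite !mxE.
transitivity (\sum_q \sum_r f q * g r *
    ((psrc r == i)%:R * (ptgt q == j)%:R * (ptgt r == psrc q)%:R)).
  under eq_bigr => p _ do rewrite [(f * g) p]pmulE.
  rewrite exchange_big /=; apply: eq_bigr => q _.
  rewrite exchange_big /=; apply: eq_bigr => r _.
  by rewrite -mulr_sumr sum_pcomp.
transitivity (\sum_q \sum_r \sum_k f q * (ptgt q == j)%:R * (psrc q == k)%:R *
    (g r * (psrc r == i)%:R * (ptgt r == k)%:R)).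
  apply: eq_bigr => q _; apply: eq_bigr => r _.
  rewrite (bigD1 (psrc q)) //= eqxx big1 => [|k kq].
    rewrite addr0 mulr1; ring.
  by rewrite [psrc q == k]eq_sym (negPf kq) mulr0 mul0r.
have sumC (h : pathalg K n) (c : pred Q) (d : pred Q) :
    \sum_(q | c q && d q) h q = \sum_q h q * (d q)%:R * (c q)%:R.
  rewrite big_mkcond; apply: eq_bigr => q _.
  by case: (c q); case: (d q); rewrite ?mulr1 ?mulr0.
under [RHS]eq_bigr => k _ do rewrite !mxE !sumC mulr_suml.
rewrite [RHS]exchange_big; apply: eq_bigr => q _ /=.
rewrite exchange_big; apply: eq_bigr => k _.
rewrite mulr_sumr; apply: eq_bigr => r _; ring.
Qed.

Lemma path_mx_id (f : pathalg K n) i : path_mx f i i = f (idpath i).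
Proof. by rewrite mxE (sum_paths f (idpath i)). Qed.

Lemma path_mx_one : path_mx 1 = 1%:M.
Proof.
apply/matrixP => j i; rewrite [RHS]mxE.
have [->|ij] := eqVneq j i; first by rewrite path_mx_id ffunE eqxx.
rewrite mxE big1 // => p /andP[/eqP src /eqP tgt]; rewrite ffunE.
case: eqP => // p0; case/eqP: ij; rewrite -src -tgt; apply: val_inj.
by have /= -> := ptgt_val p; rewrite p0 addn0.
Qed.

Lemma pathalg_incidence :
  incidence_model (fun i j : I => (i <= j)%N) path_mx mx_path.
Proof.
split=> //.
- exact: path_mx_mul.
- exact: path_mx_one.
- by move=> f; apply/ffunP => p; rewrite ffunE mxE (sum_paths f p).
- by move=> f i j ij; rewrite mxE sum_paths0.
move=> m mS; apply/matrixP => j i; rewrite mxE.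
have [ij|ij] := boolP (i <= j)%N; last by rewrite sum_paths0 // mS.
by have [p [<- <-]] := qpath_between ij; rewrite sum_paths ffunE.
Qed.

Lemma vertex_simple_mod i : vertex_mod path_mx i (idfun : vertex_simple K i -> K).
Proof.
split=> //; first by exists 1.
by move=> f x; rewrite path_mx_id.
Qed.

End PathMatrix.

(** * The Borel subalgebra *)

Section BorelSubalgebra.

Variables (K : fieldType) (n : nat) (A : falgType K).
Local Notation I := 'I_n.+1.
Local Notation leqI := (fun i j : I => (i <= j)%N).
Variables (phi : {linear A -> 'M[K]_n.+1}) (psi : 'M[K]_n.+1 -> A).
Hypothesis inc : incidence_model leqI phi psi.

Variable le : rel I.
Hypotheses (le_refl : reflexive le) (le_anti : antisymmetric le) (le_trans : transitive le).
Hypothesis le_convexl : forall i j k : I, (i <= j)%N -> (j <= k)%N -> le k i -> le j i.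
Hypothesis le_convexr : forall i j k : I, (i <= j)%N -> (j <= k)%N -> le i k -> le j k.
Hypothesis le_lca : forall i j : I, (i <= j)%N ->
  exists m : I, [/\ (i <= m)%N, (m <= j)%N, le i m & le j m].

Definition borel_rel : rel I := fun i j => (i <= j)%N && le i j.
Local Notation RB := borel_rel.

(** [t] is the least vertex from [i] on that is not below [i] in the order. The vertex of [i, t]
    dominating [i] and [t] must be [t]: any earlier one is below [i], which would put [t] below [i].
    Beyond [t], convexity excludes the rest. *)
Lemma le_next (i : I) : (forall j : I, (i <= j)%N -> le j i) \/
  exists t : I, [/\ (i < t)%N, le i t & forall j : I, (i <= j)%N -> le j i = (j < t)%N].
Proof.
have [[t0 /andP[it0 nt0]]|nt] := pselect (exists t : I, (i <= t)%N && ~~ le t i); last first.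
  by left=> j ij; apply: contrapT => ji; apply: nt; exists j; rewrite ij; apply/negP.
right; pose Q (t : I) := (i <= t)%N && ~~ le t i.
case: (@arg_minnP _ t0 Q val) => [|t /andP[it nti] tmin]; first exact/andP.
have ti : (i < t)%N.
  rewrite ltn_neqAle it andbT; apply: contraNneq nti => /val_inj ->; exact: le_refl.
have tle (j : I) : (i <= j)%N -> (j < t)%N -> le j i.
  move=> ij jt; apply: contraTT jt => nji; rewrite -leqNgt.
  by apply: tmin; apply/andP.
exists t; split=> // [|j ij].
  have [m [im mt lim ltm]] := le_lca it.
  have [->//|mt'] := eqVneq t m.
  have lmi : le m i by apply: tle => //; rewrite ltn_neqAle mt eq_sym mt'.
  by move: nti; rewrite (le_trans ltm lmi).
have [jt|tj] := ltnP j t; first exact: tle.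
by apply: contraNF nti => ji; apply: le_convexl ji.
Qed.

Lemma le_next_chain (i : I) : (forall j : I, leqI i j -> le j i) \/
  exists t : I, [/\ leqI i t, le i t, i != t &
    forall j : I, leqI i j -> le j i = ~~ leqI t j].
Proof.
have [ige|[t [it lit tE]]] := le_next i; [by left|right].
exists t; split=> //; first exact: ltnW.
  by rewrite -val_eqE /= neq_ltn it.
by move=> j ij; rewrite tE // ltnNge.
Qed.

(** The same [t] serves [B]: if [i <= t <= j] and [i] is below [j] in the order, convexity puts [t]
    below [j]. *)
Lemma le_next_borel (i : I) : (forall j, RB i j -> le j i) \/
  exists t, [/\ RB i t, le i t, i != t & forall j, RB i j -> le j i = ~~ RB t j].
Proof.
have [ige|[t [it lit tE]]] := le_next i; [left|right].
  by move=> j /andP[ij _]; apply: ige.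
exists t; split=> //; first by rewrite /borel_rel ltnW.
  by rewrite -val_eqE /= neq_ltn it.
move=> j /andP[ij lij]; rewrite tE // /borel_rel ltnNge negb_and.
case: leqP => //= tj; rewrite (le_convexr _ _ lij) //; exact: ltnW.
Qed.

Lemma borel_rel_trans i j k : RB i j -> RB j k -> RB i k.
Proof.
move=> /andP[ij lij] /andP[jk ljk]; rewrite /borel_rel (leq_trans ij jk).
exact: le_trans ljk.
Qed.

Lemma borel_exists : exists B : {aspace A},
  forall a, a \in B <-> forall i j, ~~ RB i j -> phi a j i = 0.
Proof.
pose off (a : A) : 'M[K]_n.+1 := \matrix_(j, i) (phi a j i *+ ~~ RB i j).
have off_linear : linear off.
  move=> c a b; apply/matrixP => j i; rewrite !mxE linearP /= !mxE.
  by case: (RB i j); rewrite //= !mulr0n mulr0 addr0.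
pose offL : {linear A -> 'M[K]_n.+1} := HB.pack off (GRing.isLinear.Build _ _ _ _ off off_linear).
pose U := lker (linfun offL).
have memU a : a \in U <-> forall i j, ~~ RB i j -> phi a j i = 0.
  rewrite memv_ker lfunE /=; split=> [/eqP off0 i j ij|a0].
    by move/matrixP: off0 => /(_ j i); rewrite !mxE ij.
  apply/eqP/matrixP => j i; rewrite !mxE.
  by have [//|/a0->] := boolP (RB i j).
have UA : is_aspace U.
  rewrite /is_aspace has_algid1 /=.
    apply/prodvP => a b /memU aU /memU bU; apply/memU => i j ij.
    rewrite (phi_mul inc) mxE big1 // => k _.
    have [ik|/bU->] := boolP (RB i k); last by rewrite mulr0.
    have [kj|/aU->] := boolP (RB k j); last by rewrite mul0r.
    by rewrite (borel_rel_trans ik kj) in ij.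
  apply/memU => i j ij; rewrite (phi_one inc) mxE; case: eqP => // ji.
  by move: ij; rewrite ji /borel_rel leqnn le_refl.
by exists (ASpace UA).
Qed.

Variable B : {aspace A}.
Hypothesis memB : forall a, a \in B <-> forall i j, ~~ RB i j -> phi a j i = 0.
Local Notation S := (subvs_of B).

Definition phiB : {linear S -> 'M[K]_n.+1} := phi \o vsval.
Definition psiB (m : 'M[K]_n.+1) : S := vsproj B (psi m).

Lemma borel1 : 1 \in B.
Proof.
apply/memB => i j ij; rewrite (phi_one inc) mxE; case: eqP => // ji.
by move: ij; rewrite ji /borel_rel leqnn le_refl.
Qed.

Lemma borel_incidence : incidence_model RB phiB psiB.
Proof.
split.
- by move=> i; rewrite /borel_rel leqnn le_refl.
- by move=> i j /andP[].
- by move=> a b; apply: (phi_mul inc).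
- by rewrite -[LHS]/(phi (vsval 1)) (vsval_one borel1) (phi_one inc).
- by move=> a; rewrite /psiB /phiB /= (phiK inc) vsvalK.
- by move=> a i j; apply: (memB (vsval a)).1 (subvsP a) i j.
- move=> m mS; have mE : phi (psi m) = m.
    apply: (psiK inc) => i j ij; apply: mS; apply: contraNN ij; by case/andP.
  have mB : psi m \in B by apply/memB => i j ij; rewrite mE; apply: mS.
  by rewrite -[LHS]/(phi (vsval (vsproj B (psi m)))) vsprojK.
Qed.

Local Notation incB := borel_incidence.
Local Notation e i := (munit psi i i).
Local Notation eB i := (munit psiB i i).

Lemma vsval_munit i j : RB i j -> vsval (munit psiB j i) = munit psi j i.
Proof.
move=> ij; apply: (can_inj (phiK inc)).
rewrite -[LHS]/(phiB (munit psiB j i)) (phi_munit incB ij).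
by rewrite (phi_munit inc) //; case/andP: ij.
Qed.

Lemma vsval_e i : vsval (eB i) = e i.
Proof. by apply: vsval_munit; rewrite /borel_rel leqnn le_refl. Qed.

(* The support of the standard module at [m]. *)
Definition std_supp (m j : I) : bool := (m <= j)%N && le j m.

(** Say [m <= m']. Convexity between [m] and [j] puts [m'] below [m], and convexity between [i] and
    [m'] puts [m] below [m']. *)
Lemma lca_unique (i j m m' : I) : RB i m -> std_supp m j -> RB i m' -> std_supp m' j -> m = m'.
Proof.
wlog mm' : m m' / (m <= m')%N.
  move=> W im mj im' m'j; have [|/ltnW] := leqP m m'; first by move/W; apply.
  by move/W => <-.
move=> /andP[im lim] /andP[mj ljm] /andP[im' lim'] /andP[m'j ljm'].
apply: le_anti; rewrite (le_convexr im mm' lim') /=.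
exact: le_convexl mm' m'j ljm.
Qed.

(** Precomposing with a path of [B] does not change the vertex through which a path to [j] factors;
    this makes the dual forms right linear over [B]. *)
Lemma borel_rel_divide (i k j m : I) : RB i k -> (k <= j)%N -> std_supp m j ->
  RB i m = RB k m.
Proof.
move=> ik kj mj; apply/idP/idP => [im|]; last exact: borel_rel_trans ik.
case/andP: ik => ik lik; case/andP: mj => mj ljm; case/andP: im => im lim.
have [km|mk] := leqP k m; first by rewrite /borel_rel km (le_convexr ik km lim).
have lkm := le_convexl (ltnW mk) kj ljm.
have lmk := le_convexr im (ltnW mk) lik.
have km : k = m by apply: le_anti; rewrite lkm lmk.
by rewrite km /borel_rel leqnn le_refl.
Qed.

(* [dual_form (j, m) a] divides by the path from [m] to [j] the part of [a] on *)
(* the paths to [j] whose factorisation passes through [m].                    *)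
Definition dual_mx (t : I * I) (a : A) : 'M[K]_n.+1 := \matrix_(m, i)
  (phi a t.1 i *+ [&& m == t.2, RB i t.2 & std_supp t.2 t.1]).
Definition dual_vec (t : I * I) : A := munit psi t.1 t.2.
Definition dual_form (t : I * I) (a : A) : S := psiB (dual_mx t a).

Lemma phi_dual_form t a : phiB (dual_form t a) = dual_mx t a.
Proof.
apply: (psiK incB) => i j ij; rewrite mxE; case: eqP => // jt.
by rewrite jt in ij; rewrite (negPf ij).
Qed.

Lemma dual_formD t : {morph dual_form t : a b / a + b}.
Proof.
move=> a b; apply: (can_inj (phiK incB)); rewrite linearD !phi_dual_form.
by apply/matrixP => m i; rewrite !mxE linearD mxE mulrnDl.
Qed.

Lemma dual_formM t a (b : S) : dual_form t (a * vsval b) = dual_form t a * b.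
Proof.
apply: (can_inj (phiK incB)); rewrite (phi_mul incB) !phi_dual_form.
apply/matrixP => m i; rewrite !mxE (phi_mul inc) mxE -sumrMnl.
apply: eq_bigr => k _; rewrite mxE -[phi (vsval b)]/(phiB b) -mulrnAl.
have [ik|ik] := boolP (RB i k); last by rewrite (phi_supp incB) ?mulr0.
have [kj|kj] := boolP (k <= t.1)%N; last by rewrite (phi_supp inc) // !mul0rn.
case: (m == t.2) => //=; have [mj|] := boolP (std_supp _ _); last by rewrite !andbF.
by rewrite (borel_rel_divide ik kj mj).
Qed.

(** The entry of [a] at [(j, i)] is produced exactly once, by the pair of [j] and the largest vertex
    of the interval [i, j]. *)
Lemma dual_formE a : a = \sum_t dual_vec t * vsval (dual_form t a).
Proof.
apply: (can_inj (phiK inc)); apply/matrixP => j i; rewrite linear_sum summxE /=.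
have E (t : I * I) : phi (dual_vec t * vsval (dual_form t a)) j i =
    phi a j i *+ [&& t.1 == j, RB i t.2 & std_supp t.2 j].
  rewrite (phi_mul inc) -[phi (vsval _)]/(phiB _) phi_dual_form mxE.
  rewrite (bigD1 t.2) //= big1 ?addr0 => [|k kt]; last first.
    by rewrite [X in _ * X]mxE (negPf kt) mulr0n mulr0.
  rewrite mxE eqxx /=.
  have [tt|ntt] := boolP (std_supp t.2 t.1); last first.
    rewrite !andbF mulr0n mulr0; case: eqP => [<-|//].
    by rewrite (negPf ntt) andbF.
  rewrite andbT (phi_munit inc); last by case/andP: tt.
  rewrite mxE eqxx andbT eq_sym; case: eqP => [tj|_] /=; last by rewrite mul0r.
  by rewrite mul1r -tj tt andbT.
under eq_bigr => t _ do rewrite E.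
have [ij|ij] := boolP (i <= j)%N; last first.
  by rewrite (phi_supp inc) // big1 // => t _; rewrite mul0rn.
have [m [im mj lim ljm]] := le_lca ij.
have im' : RB i m by rewrite /borel_rel im.
have mj' : std_supp m j by rewrite /std_supp mj.
rewrite (bigD1 (j, m)) //= eqxx im' mj' mulr1n big1 ?addr0 // => -[j' m'] /=.
case: (j' =P j) => //= -> /eqP jm; case: andP => // -[im'' mj''].
by case: jm; rewrite (lca_unique im' mj' im'' mj'').
Qed.

(** * Simple modules of [B], the modules they induce, and Ext *)

Section Simples.

Variables (L : I -> lmodType A) (l : forall i, L i -> K).
Hypothesis vmL : forall i, vertex_mod phi i (@l i).

Definition borel_simple i : lmodType S := restr borel1 (L i).
Local Notation LB := borel_simple.
Local Notation lB := (fun i (x : LB i) => l (x : L i)).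

Lemma borel_simple_vm i : vertex_mod phiB i (lB i).
Proof.
split; [exact: (vm_add (vmL i))|exact: (vm_inj (vmL i))|exact: (vm_surj (vmL i))|].
by move=> a x; apply: (vm_act (vmL i)).
Qed.
Local Notation vmB := borel_simple_vm.

Definition gen i : LB i := sval (cid (vm_surj (vmL i))).

Lemma gen1 i : l (gen i) = 1.
Proof. exact: svalP (cid (vm_surj (vmL i))). Qed.

Definition std_map i : {linear idmod (e i) -> tens (LB i)} :=
  sval (cid (idmod_map (e i) (pure_tensor 1 (gen i)))).

Lemma std_mapE i x : std_map i x = pure_tensor (idval x) (gen i).
Proof.
rewrite [LHS](svalP (cid (idmod_map (e i) (pure_tensor 1 (gen i)))) x).
by rewrite pure_scale mulr1.
Qed.

Lemma pure_gen i (a : A) (y : LB i) : exists x, pure_tensor a y = std_map i x.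
Proof.
have [|x xE] := @idmod_of _ _ (e i) (l y *: (a * e i)).
  by rewrite -scalerAl -mulrA (e_idem inc).
exists x; rewrite std_mapE xE -vsval_e -mulr_algr.
rewrite (_ : (l y)%:A = vsval (l y *: 1 : S)); last first.
  by rewrite -[RHS]/(l y *: vsval (1 : S)) (vsval_one borel1).
rewrite -mulrA -[vsval _ * vsval _]/(vsval (eB i * (l y *: 1))) pure_bal.
congr (pure_tensor _ _); rewrite mulr_algr.
rewrite kscE (vm_e incB (vmB i)) eqxx.
by rewrite {1}[y](vm_gen incB (vmB i) (gen1 i)).
Qed.

Lemma std_map_surj i : Defs.surjective (std_map i).
Proof.
elim/tens_ind => [|a m u [x <-]]; first by exists 0; rewrite linear0.
by have [y ->] := pure_gen a m; exists (y + x); rewrite linearD.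
Qed.

(** The dual basis coordinates of [std_map i x] are the entries of [x] on the standard support. Thus
    [tens (LB i)] itself can play the standard module in the general criterion. *)
Lemma std_map_ker i x :
  std_map i x = 0 <-> forall j, le j i -> phi (idval x) j i = 0.
Proof.
have [c [cD cp cE]] := dual_basis_coord dual_formD dual_formM dual_formE (LB i).
have lc t : l (c t (std_map i x)) =
    phi (idval x) t.1 i *+ [&& i == t.2, RB i t.2 & std_supp t.2 t.1].
  by rewrite std_mapE cp (vm_act (vmB i)) gen1 mulr1 phi_dual_form mxE.
split=> [x0 j ji|x0].
  have [ij|] := boolP (i <= j)%N; last exact: (phi_supp inc).
  have := lc (j, i); rewrite x0 eqxx /std_supp ij ji /borel_rel leqnn le_refl mulr1n => <-.
  have -> : c (j, i) 0 = 0 by apply: (addrI (c (j, i) 0)); rewrite -cD !addr0.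
  exact: (vm0 (vmL i)).
rewrite [LHS]cE big1 // => t _; rewrite (_ : c t _ = 0) ?pure0r //.
apply: (vm_eq0 (vmL i)); rewrite lc; case: and3P => // -[/eqP it _ /andP[_ ti]].
by rewrite x0 // it.
Qed.

Lemma path_quasi_hereditary : quasi_hereditary le L.
Proof.
exact: (incidence_quasi_hereditary inc vmL le_refl le_anti le_trans std_map_surj
  std_map_ker le_next_chain).
Qed.

Definition borel_top i : {linear idmod (eB i) -> LB i} :=
  sval (cid (top_map psiB borel_simple_vm i)).

Lemma borel_topE i x : l (borel_top i x) = phiB (idval x) i i.
Proof. exact: svalP (cid (top_map psiB borel_simple_vm i)) x. Qed.

Lemma borel_top_surj i : Defs.surjective (borel_top i).
Proof. exact: (top_map_surj incB borel_simple_vm (@borel_topE i)). Qed.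

(** Paths of [B] go up in the tree order, so from [i] only [i] itself is reached among the [j] below
    [i]: the standard modules of [B] are simple. *)
Lemma borel_top_ker i x :
  borel_top i x = 0 <-> forall j, le j i -> phiB (idval x) j i = 0.
Proof.
split=> [x0 j ji|x0]; last by apply: (vm_eq0 (vmL i)); rewrite borel_topE x0.
have [/andP[_ ij]|] := boolP (RB i j); last exact: (phi_supp incB).
have -> : j = i by apply: le_anti; rewrite ji ij.
by rewrite -borel_topE x0 (vm0 (vmL i)).
Qed.

Lemma borel_quasi_hereditary : quasi_hereditary le LB.
Proof.
exact: (incidence_quasi_hereditary incB borel_simple_vm le_refl le_anti le_trans
  borel_top_surj borel_top_ker le_next_borel).
Qed.

Lemma borel_exact : exact_borel le L LB.
Proof.
split; [exact: borel1|exact: borel_quasi_hereditary|move=> i D| |move=> i].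
- apply: (standard_simple incB borel_simple_vm borel_top_surj borel_top_ker).
  exact: (vm_simple incB (vmB i)).
- exact: dual_basis_tens_exact dual_formD dual_formM dual_formE.
- exists (tens (LB i)); last exact: lmod_iso_refl.
  exact: (std_standard inc vmL std_map_surj std_map_ker).
Qed.

Lemma std_source (i j : I) (z : tens (LB j)) : (i < j)%N -> e i *: z = 0.
Proof.
move=> ij; have [x <-] := std_map_surj z; rewrite -linearZ; apply/std_map_ker => k _.
rewrite idvalZ (phi_mul inc) (phi_e inc) delta_mul_mx; case: eqP => [->|]; last by rewrite mul0r.
by rewrite (phi_supp inc) ?mulr0 // -ltnNge.
Qed.

Lemma tens_idmod_eq i (N : lmodType A) (f g : {linear tens (idmod (eB i)) -> N}) x :
  idval x = eB i -> f (pure_tensor 1 x) = g (pure_tensor 1 x) -> f =1 g.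
Proof.
move=> xe fg; apply: tens_lin_eq => m.
have -> : m = idval m *: x by apply: idval_inj; rewrite idvalZ xe idvalP.
by rewrite pure1Z !linearZ /= fg.
Qed.

(** A (x)_B B e_i is A e_i, so maps from it to [N] amount to elements of [e i N]. *)
Lemma tens_idmod_map i (N : lmodType A) (w : N) : e i *: w = w ->
  exists h : {linear tens (idmod (eB i)) -> N},
    forall x, idval x = eB i -> h (pure_tensor 1 x) = w.
Proof.
move=> iw; have [||||h hE] := @tens_lift_linear _ _ _ (idmod (eB i)) N
    (fun a x => (a * vsval (idval x)) *: w).
- by move=> a a' m; rewrite mulrDl scalerDl.
- by move=> a m m'; rewrite idvalD linearD mulrDr scalerDl.
- by move=> a r m; rewrite idvalZ -mulrA.
- by move=> a a' m; rewrite -mulrA -scalerA.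
by exists h => x xe; rewrite hE xe mul1r vsval_e.
Qed.

Lemma pure1_eq0 j (y : LB j) : pure_tensor 1 y = 0 -> y = 0.
Proof.
have [c [cD cp _]] := dual_basis_coord dual_formD dual_formM dual_formE (LB j).
move=> y0; have := cp (j, j) 1 y; rewrite y0.
have -> : c (j, j) 0 = 0 by apply: (addrI (c (j, j) 0)); rewrite -cD !addr0.
move/(congr1 (@l j)); rewrite (vm0 (vmL j)) (vm_act (vmB j)) phi_dual_form.
rewrite mxE (phi_one inc) mxE eqxx /std_supp /borel_rel leqnn le_refl mul1r => l0.
exact/(vm_eq0 (vmL j)).
Qed.

Lemma std_vertex j (z : tens (LB j)) : e j *: z = z -> exists y : LB j, z = pure_tensor 1 y.
Proof.
move=> <-; have [x <-] := std_map_surj z; rewrite -linearZ std_mapE idvalZ.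
exists ((phi (idval x) j j *: eB j) *: gen j).
rewrite -pure_bal mul1r linearZ /= vsval_e -(e_mul_e inc) -mulrA.
by rewrite idvalP.
Qed.

Lemma borel_ext k i j : tens_ext_iso (LB i) (LB j) k.
Proof.
have finj := dual_basis_inj dual_formD dual_formM dual_formE.
have fex := dual_basis_exact dual_formD dual_formM dual_formE.
have prB t : projective (idmod (eB t)) by apply/idmod_projective/(e_idem incB).
have [di|[t [d [[/andP[it _] lit nit tE] dex dE]]]] :=
    std_next incB borel_top_surj borel_top_ker le_next_borel i.
  (* Here L_B(i) is projective, and the resolution has a zero module in degree one. *)
  have [d dex] := ker_short_exact (@borel_top_surj i).
  have X0 (x : lin_ker (borel_top i)) : x = 0.
    by apply: val_inj; apply: (inj_exact0 di); apply/eqP/(valP x).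
  apply: (tens_ext_iso_length_one borel1 finj fex (@tens_map_surj _ _ _) dex (prB i)).
  - move=> M N g f gs; exists \0 => x.
    by rewrite (X0 x) !linear0.
  - by move=> f _; exists \0 => x; rewrite (X0 x) !linear0.
  - move=> g; exists \0, \0; elim/tens_ind => [|a m u IHu].
      by rewrite !linear0 addr0.
    by rewrite (X0 m) pure0r add0r.
have it' : (i < t)%N by rewrite ltn_neqAle it andbT.
have [xt xtE] := munit_idmod incB (inc_refl incB t).
have [xi xiE] := munit_idmod incB (inc_refl incB i).
have RBit : RB i t by rewrite /borel_rel it.
have dxt : d xt = munit psiB t i *: xi.
  apply: idval_inj; rewrite dE xtE idvalZ xiE !(munit_mul incB) //; exact: (inc_refl incB).
have pdxt : pure_tensor 1 (d xt) = munit psi t i *: pure_tensor 1 xi.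
  by rewrite dxt pure1Z vsval_munit.
have exi : e i *: pure_tensor 1 xi = pure_tensor 1 xi.
  rewrite -vsval_e -pure1Z; congr (pure_tensor _ _); apply: idval_inj.
  by rewrite idvalZ xiE (e_idem incB).
have ext : e t *: pure_tensor 1 xt = pure_tensor 1 xt.
  rewrite -vsval_e -pure1Z; congr (pure_tensor _ _); apply: idval_inj.
  by rewrite idvalZ xtE (e_idem incB).
apply: (tens_ext_iso_length_one borel1 finj fex (@tens_map_surj _ _ _) dex (prB i) (prB t)).
  (* Injectivity: [f] is zero. Indeed [f xt] lives at [t], so only [t = j] matters, and then its
     tensor is a multiple of an element of the standard module at [j] located at [i < j]. *)
  move=> f [g gE]; exists \0 => x.
  rewrite (idmod_linE f x xtE) (_ : f xt = 0) ?scaler0 //.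
  have [tj|tj] := eqVneq t j; last first.
    have -> : xt = eB t *: xt by apply: idval_inj; rewrite idvalZ xtE (e_idem incB).
    by rewrite linearZ /= (vm_e incB (vmB j)) (negPf tj).
  apply: pure1_eq0; have := gE (pure_tensor 1 xt).
  rewrite /= !tens_map_pure pdxt linearZ /= -exi linearZ /= std_source ?scaler0 //.
  by rewrite -tj.
(* Surjectivity: [g] is determined by [z], a component at [t] of the standard module at [j], and
   [gext] reduces the claim to this one element. *)
move=> g; pose z := g (pure_tensor 1 xt).
have ez : e t *: z = z by rewrite /z -linearZ /= ext.
have gext (f : {linear idmod (eB t) -> LB j}) (h : {linear tens (idmod (eB i)) -> tens (LB j)}) :
    pure_tensor 1 (f xt) - z = munit psi t i *: h (pure_tensor 1 xi) ->
    exists (f : {linear idmod (eB t) -> LB j}) (h : {linear tens (idmod (eB i)) -> tens (LB j)}),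
    forall x, tens_map f x - g x = h (tens_map d x).
  move=> fh; exists f, h.
  pose F1 : {linear tens (idmod (eB t)) -> tens (LB j)} := tens_map f \- g.
  pose F2 : {linear tens (idmod (eB t)) -> tens (LB j)} := h \o tens_map d.
  apply: (@tens_idmod_eq t _ F1 F2 xt xtE).
  by rewrite /F1 /F2 /= !tens_map_pure pdxt linearZ /= fh.
have [z0|z0] := eqVneq z 0.
  by apply: (gext \0 \0); rewrite /= pure0r z0 subr0 scaler0.
have jt : (j <= t)%N by rewrite leqNgt; apply: contra_neqN z0 => tj; rewrite -ez std_source.
have ltj : le t j.
  apply: contra_neqT z0 => ntj; rewrite -ez.
  exact: (std_e inc std_map_surj std_map_ker).
have [tj|tj] := eqVneq t j.
  have [y yE] := std_vertex (z := z) (etrans (congr1 (fun s => e s *: z) (esym tj)) ez).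
  have [f fE] := idmod_map (eB t) y.
  apply: (gext f \0); rewrite /= scaler0 fE xtE (vm_e incB (vmB j)) tj eqxx -yE.
  exact: subrr.
have lij : le i j := le_trans lit ltj.
have jt' : (j < t)%N.
  by rewrite ltn_neqAle jt andbT; apply: contraNneq tj => /val_inj ->.
(* If [i < j < t], the choice of [t] would put [j] below [i] in the order, against [lij]. *)
have ji : (j <= i)%N.
  rewrite leqNgt; apply/negP => ij.
  have lji : le j i.
    by rewrite tE /borel_rel ?(ltnW ij) ?lij // negb_and -ltnNge jt'.
  have ijE : i = j by apply: le_anti; rewrite lij lji.
  by rewrite ijE ltnn in ij.
have [y yE] := std_map_surj z.
have ju : (munit psi i j) * e j = munit psi i j.
  exact: (munit_mul inc) (leqnn j) ji.
(* As [j <= i <= t], the coefficient of [z] at [t] can already be placed at [i]; the path from [i]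
   to [t] carries it to [z], so [g] is a coboundary. *)
have [|w wE] := @idmod_of _ _ (e j) (phi (idval y) t j *: munit psi i j).
  by rewrite -scalerAl ju.
have iw : e i *: std_map j w = std_map j w.
  rewrite -linearZ; congr (std_map j _); apply: idval_inj.
  by rewrite idvalZ wE -scalerAr (munit_mul inc ji (leqnn i)).
have tw : munit psi t i *: std_map j w = z.
  rewrite -ez -yE -!linearZ; congr (std_map j _); apply: idval_inj.
  rewrite !idvalZ wE -scalerAr (munit_mul inc ji it).
  by rewrite -[idval y in RHS]idvalP mulrA (e_mul_e inc).
have [|h hE] := @tens_idmod_map i _ (- std_map j w); first by rewrite scalerN iw.
apply: (gext \0 h); rewrite hE //= pure0r sub0r scalerN.
by rewrite tw.
Qed.

Lemma borel_regular : regular_exact_borel le L B.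
Proof. by exists LB; split; [apply: borel_exact|apply: borel_ext]. Qed.

End Simples.

End BorelSubalgebra.

Theorem proposition24 (K : closedFieldType) (n : nat) (T : bintree)
    (hT : nvertices T = n.+1) :
  let L : 'I_n.+1 -> lmodType (pathalg K n) := fun i => vertex_simple K i in
  quasi_hereditary (@tree_le n.+1 T) L /\
  exists B : {aspace (pathalg K n)},
    regular_exact_borel (@tree_le n.+1 T) L B.
Proof.
move=> L; pose inc := @pathalg_incidence K n.
have vmL i : vertex_mod (path_mx (n := n)) i (idfun : L i -> K).
  exact: vertex_simple_mod.
have refl := @tree_le_refl n.+1 T; have anti := @tree_le_anti n.+1 T.
have trans := @tree_le_trans n.+1 T.
have convl := @tree_le_convexl n.+1 T; have convr := @tree_le_convexr n.+1 T.
have lca := tree_le_lca hT.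
have [B memB] := borel_exists inc refl trans.
split; first exact: (path_quasi_hereditary inc refl anti trans convl convr lca memB vmL).
by exists B; apply: (borel_regular inc refl anti trans convl convr lca memB vmL).
Qed.
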